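(* Let $(C,\alpha,\triangle_\prec,\triangle_\succ)$ be a multiplicative hom-dendriform coalgebra over $\mathbb{K}$. If $H^2_{\alpha,\mathrm{coDend}}(C,C)=0$, then every deformation of $C$ is equivalent to a trivial deformation.
   Context: $\mathbb{K}$ is a field of characteristic zero; all spaces and maps are over $\mathbb{K}$. A multiplicative hom-dendriform coalgebra $(C,\alpha,\triangle_\prec,\triangle_\succ)$ is a vector space $C$ with a linear map $\alpha:C\to C$ and linear maps $\triangle_\prec,\triangle_\succ:C\to C\otimes C$ such that $(\triangle_\prec\otimes\alpha)\circ\triangle_\prec=(\alpha\otimes(\triangle_\prec+\triangle_\succ))\circ\triangle_\prec$; $(\triangle_\succ\otimes\alpha)\circ\triangle_\prec=(\alpha\otimes\triangle_\prec)\circ\triangle_\succ$; $((\triangle_\prec+\triangle_\succ)\otimes\alpha)\circ\triangle_\succ=(\alpha\otimes\triangle_\succ)\circ\triangle_\succ$; and $(\alpha\otimes\alpha)\circ\triangle_\prec=\triangle_\prec\circ\alpha$, $(\alpha\otimes\alpha)\circ\triangle_\succ=\triangle_\succ\circ\alpha$. Cohomology. Let $C_n=\{[1],\dots,[n]\}$ (a set of labels, not to be confused with $C$) and let $\mathbb{K}[C_n]$ be the vector space with basis $C_n$. For $m,n\ge1$, $1\le i\le m$, define maps $R_0=R_0(m;1,\dots,n,\dots,1):C_{m+n-1}\to C_m$ and $R_i=R_i(m;1,\dots,n,\dots,1):C_{m+n-1}\to\mathbb{K}[C_n]$ (with $n$ in the $i$-th place) by: $R_0[r]=[r]$ if $r\le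 i-1$, $R_0[r]=[i]$ if $i\le r\le i+n-1$, $R_0[r]=[r-n+1]$ if $i+n\le r\le m+n-1$; and $R_i[r]=[r-(i-1)]$ if $i\le r\le i+n-1$, $R_i[r]=[1]+\cdots+[n]$ otherwise. For $n\ge1$, $C^n_{\alpha,\mathrm{coDend}}(C,C)$ is the space of linear maps $\sigma:\mathbb{K}[C_n]\otimes C\to C^{\otimes n}$ with $\alpha^{\otimes n}(\sigma([r];c))=\sigma([r];\alpha(c))$ for all $[r]\in C_n$; $C^0_{\alpha,\mathrm{coDend}}(C,C)=0$. For $\sigma$ of arity $m$, $\tau$ of arity $n$, $1\le i\le m$: $$(\sigma\bullet_i\tau)([r];-)=\big((\alpha^{n-1})^{\otimes(i-1)}\otimes\tau(R_i[r];-)\otimes(\alpha^{n-1})^{\otimes(m-i)}\big)\circ\sigma(R_0[r];-),$$ and $\sigma\bullet\tau=\sum_{i=1}^m(-1)^{(i-1)(n-1)}\sigma\bullet_i\tau$. Let $\triangle\in C^2_{\alpha,\mathrm{coDend}}(C,C)$ be given by $\triangle([1];-)=\triangle_\prec$, $\triangle([2];-)=\triangle_\succ$. The differential is $\delta_{\alpha,\mathrm{coDend}}(\sigma)=\triangle\bullet\sigma-(-1)^{n-1}\sigma\bullet\triangle$ for $\sigma\in C^n_{\alpha,\mathrm{coDend}}(C,C)$, and $H^n_{\alpha,\mathrm{coDend}}(C,C)$ is its cohomology. Deformations. A deformation of $(C,\alpha,\triangle_\prec,\triangle_\succ)$ is given by formal sums $\triangle_{\prec,t}=\sum_{i\ge0}t^i\triangle_{\prec,i}$,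 $\triangle_{\succ,t}=\sum_{i\ge0}t^i\triangle_{\succ,i}$ of linear maps $C\to C\otimes C$, with $\triangle_{\prec,0}=\triangle_\prec$, $\triangle_{\succ,0}=\triangle_\succ$, such that $(C[[t]],\alpha,\triangle_{\prec,t},\triangle_{\succ,t})$ is a multiplicative hom-dendriform coalgebra over $\mathbb{K}[[t]]$; this is understood coefficientwise in $t$ (values in $(C\otimes C)[[t]]$): all $\triangle_{\prec,i},\triangle_{\succ,i}$ satisfy $(\alpha\otimes\alpha)\circ\triangle_{\ast,i}=\triangle_{\ast,i}\circ\alpha$ for $\ast\in\{\prec,\succ\}$, and for each $n\ge0$: $\sum_{i+j=n}(\triangle_{\prec,i}\otimes\alpha)\circ\triangle_{\prec,j}=\sum_{i+j=n}(\alpha\otimes(\triangle_{\prec,i}+\triangle_{\succ,i}))\circ\triangle_{\prec,j}$; $\sum_{i+j=n}(\triangle_{\succ,i}\otimes\alpha)\circ\triangle_{\prec,j}=\sum_{i+j=n}(\alpha\otimes\triangle_{\prec,i})\circ\triangle_{\succ,j}$; $\sum_{i+j=n}((\triangle_{\prec,i}+\triangle_{\succ,i})\otimes\alpha)\circ\triangle_{\succ,j}=\sum_{i+j=n}(\alpha\otimes\triangle_{\succ,i})\circ\triangle_{\succ,j}$. Two deformations $(\triangle_{\prec,t},\triangle_{\succ,t})$ and $(\triangle'_{\prec,t},\triangle'_{\succ,t})$ are equivalent if there is a formal isomorphism $\Phi_t=\sum_{i\ge0}t^i\Phi_i:C[[t]]\to C[[t]]$, with each $\Phi_i:C\to C$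 linear and commuting with $\alpha$ and $\Phi_0=\mathrm{id}_C$, such that $\triangle'_{\prec,t}\circ\Phi_t=(\Phi_t\otimes\Phi_t)\circ\triangle_{\prec,t}$ and $\triangle'_{\succ,t}\circ\Phi_t=(\Phi_t\otimes\Phi_t)\circ\triangle_{\succ,t}$ (coefficientwise in $t$). A deformation is trivial if it is equivalent to the constant deformation $(\triangle'_{\prec,t}=\triangle_\prec,\triangle'_{\succ,t}=\triangle_\succ)$. *)

(* Defs.v *)
From HB Require Import structures.
From mathcomp Require Import all_boot all_order all_algebra.
From mathcomp Require Import generic_quotient ring_quotient boolp functions.
From mathcomp Require Import freeg.

Set Implicit Arguments.
Unset Strict Implicit.
Unset Printing Implicit Defensive.

Import GRing.Theory.
Local Open Scope ring_scope.

(* * Quotient vector spaces *)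

Section ModQuot.
Variables (K : fieldType) (V : lmodType K) (I : {pred V}).
Hypothesis I_closed : submod_closed I.

Definition mqker of submod_closed I : {pred V} := I.
Local Notation J := (mqker I_closed).
HB.instance Definition _ := GRing.isZmodClosed.Build V J
  (GRing.submod_closedB I_closed).

Definition modquot : Type := Quotient.quot J.
HB.instance Definition _ := GRing.Zmodule.on modquot.

Definition mqpi (v : V) : modquot := \pi_(Quotient.quot J)%qT v.
Definition mqrepr (x : modquot) : V := repr (x : Quotient.quot J).

Lemma mqreprK : cancel mqrepr mqpi.
Proof. exact: reprK. Qed.

Lemma mqpi_eq (x y : V) : (mqpi x == mqpi y) = (x - y \in I).
Proof. by rewrite -[RHS]/(x - y \in J) Quotient.idealrBE. Qed.

Lemma mqpi_is_zmod_morphism : zmod_morphism mqpi.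
Proof. by move=> x y; rewrite /mqpi raddfB. Qed.

Definition mqscale (a : K) (x : modquot) : modquot := mqpi (a *: mqrepr x).

Lemma mqscaleE a v : mqscale a (mqpi v) = mqpi (a *: v).
Proof. apply/eqP; rewrite mqpi_eq -scalerBr -[_ *: _]addr0.
case: I_closed => I0; apply=> //.
by rewrite -mqpi_eq mqreprK. Qed.

Lemma mqscaleA a b x : mqscale a (mqscale b x) = mqscale (a * b) x.
Proof. by rewrite -[x]mqreprK !mqscaleE scalerA. Qed.

Lemma mqscale1 : left_id 1 mqscale.
Proof. by move=> x; rewrite -[x]mqreprK mqscaleE scale1r. Qed.

HB.instance Definition _ :=
  GRing.isZmodMorphism.Build V modquot mqpi mqpi_is_zmod_morphism.

Lemma mqscaleDr : right_distributive mqscale +%R.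
Proof.
move=> a x y; rewrite -[x]mqreprK -[y]mqreprK -raddfD !mqscaleE -raddfD.
by rewrite scalerDr.
Qed.

Lemma mqscaleDl x : {morph mqscale^~ x : a b / a + b}.
Proof. by move=> a b; rewrite -[x]mqreprK !mqscaleE -raddfD scalerDl. Qed.

HB.instance Definition _ := GRing.Zmodule_isLmodule.Build K modquot
  mqscaleA mqscale1 mqscaleDr mqscaleDl.

Lemma mqpi_is_linear : linear mqpi.
Proof. by move=> a u v; rewrite raddfD; congr (_ + _); apply/esym/mqscaleE. Qed.

HB.instance Definition _ := GRing.isLinear.Build K V modquot *:%R mqpi
  mqpi_is_linear.

End ModQuot.

(* * Linear spans *)

Section Span.
Variables (K : fieldType) (V : lmodType K) (S : V -> Prop).

Definition span : {pred V} := fun v =>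
  `[< forall U : {pred V}, submod_closed U -> (forall x, S x -> x \in U) ->
        v \in U >].

Lemma span_submod_closed : submod_closed span.
Proof.
split=> [|a u v /asboolP hu /asboolP hv]; apply/asboolP => U Uc SU.
  by case: Uc.
by case: (Uc) => _; apply; [apply: hu | apply: hv].
Qed.

Lemma mem_span x : S x -> x \in span.
Proof. by move=> Sx; apply/asboolP => U _; apply. Qed.

Lemma span_min (U : {pred V}) :
  submod_closed U -> (forall x, S x -> x \in U) -> {subset span <= U}.
Proof. by move=> Uc SU v /asboolP; apply. Qed.

End Span.

(* * Tensor product of two vector spaces *)

Notation bilinear_map f := (bilinear_for *:%R *:%R f).

Section Linear.
Variables (K : fieldType) (V W : lmodType K).

Definition mklin (f : V -> W) (hf : linear f) : {linear V -> W} :=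
  HB.pack_for {linear V -> W} f (GRing.isLinear.Build K V W *:%R f hf).

Lemma lin0 (f : V -> W) : linear f -> f 0 = 0.
Proof. by move=> hf; exact: (raddf0 (mklin hf)). Qed.

Lemma linZ (f : V -> W) : linear f -> forall a x, f (a *: x) = a *: f x.
Proof. by move=> hf a x; exact: (linearZZ (mklin hf)). Qed.

Lemma linD (f : V -> W) : linear f -> forall x y, f (x + y) = f x + f y.
Proof. by move=> hf a x; exact: (raddfD (mklin hf)). Qed.

Lemma lin_sum (f : V -> W) I (r : seq I) (F : I -> V) : linear f ->
  f (\sum_(i <- r) F i) = \sum_(i <- r) f (F i).
Proof. by move=> hf; exact: (raddf_sum (mklin hf)). Qed.

End Linear.

Lemma lin_fun (K : fieldType) (V W : lmodType K) (f : {linear V -> W}) :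
  linear f.
Proof. exact: linearP. Qed.

Lemma lin_comp (K : fieldType) (V W X : lmodType K) (g : W -> X) (f : V -> W) :
  linear g -> linear f -> linear (fun x => g (f x)).
Proof. by move=> hg hf a x y; rewrite hf hg. Qed.

Section Tensor.
Variables (K : fieldType) (V W : lmodType K).

Local Notation free := {freeg (V * W)%type / K}.
Local Notation gen v w := (<< (v, w) >> : free).

Definition tensor_rel (x : free) : Prop :=
  (exists a v v' w, x = gen (a *: v + v') w - (a *: gen v w + gen v' w)) \/
  (exists a v w w', x = gen v (a *: w + w') - (a *: gen v w + gen v w')).

Definition tensor : Type := modquot (span_submod_closed tensor_rel).
HB.instance Definition _ := GRing.Lmodule.on tensor.

Definition tens (v : V) (w : W) : tensor := mqpi (span_submod_closed tensor_rel) (gen v w).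

Lemma tens_bilinear : bilinear_map tens.
Proof.
split=> [w a v v' | v a w w']; apply/eqP; rewrite /tens -linearP mqpi_eq;
  apply: mem_span.
  by left; exists a, v, v', w.
by right; exists a, v, w, w'.
Qed.

Lemma tensor_ind (P : tensor -> Prop) :
  (forall v w, P (tens v w)) ->
  (forall a x y, P x -> P y -> P (a *: x + y)) -> forall t, P t.
Proof.
move=> Pt PD; have P0 : P 0.
  by rewrite -(lin0 (tens_bilinear.1 0)); exact: Pt.
move=> t; rewrite -[t]mqreprK; set x := mqrepr t.
rewrite -[x]freeg_sumE raddf_sum /=; elim/big_rec: _ => // -[v w] y _ Py.
suff -> : << coeff (v, w) x *g (v, w) >> = coeff (v, w) x *: gen v w.
  by rewrite linearZZ; apply: PD => //; exact: Pt.
by apply/eqP/freeg_eqP => k; rewrite coeffZ !coeffU mul1r.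
Qed.

Lemma tensor_ext (U : lmodType K) (f g : tensor -> U) :
  linear f -> linear g -> (forall v w, f (tens v w) = g (tens v w)) -> f =1 g.
Proof.
move=> hf hg fg; elim/tensor_ind => // a x y fx fy.
by rewrite hf hg fx fy.
Qed.

(* The linear map induced by a bilinear map; meaningless if [f] is not
   bilinear. *)
Definition tlift (U : lmodType K) (f : V -> W -> U) (t : tensor) : U :=
  fglift (fun p => f p.1 p.2) (mqrepr t).

Section Lift.
Variables (U : lmodType K) (f : V -> W -> U) (hf : bilinear_map f).
Let F : free -> U := fglift (fun p => f p.1 p.2).

Let F_linear : linear F.
Proof.
have Fadd : zmod_morphism F by exact: lift_is_additive.
pose F' : {additive free -> U} :=
  HB.pack F (GRing.isZmodMorphism.Build free U F Fadd).
have Fsum I (r : seq I) (G : I -> free) :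
  F (\sum_(i <- r) G i) = \sum_(i <- r) F (G i) by exact: (raddf_sum F').
have FE x : F x = \sum_(k <- dom x) coeff k x *: f k.1 k.2.
  rewrite -{1}[x]freeg_sumE Fsum; apply: eq_bigr => k _.
  by rewrite /F liftU.
have FZ a x : F (a *: x) = a *: F x.
  rewrite -{1}[x]freeg_sumE scaler_sumr Fsum FE scaler_sumr.
  apply: eq_bigr => k _.
  have -> : a *: << coeff k x *g k >> = << (a * coeff k x) *g k >> :> free.
    by apply/eqP/freeg_eqP => z; rewrite coeffZ !coeffU mulrA.
  by rewrite /F liftU scalerA.
by move=> a x y; rewrite -FZ -[F]/(F' : _ -> _) raddfD.
Qed.

Let F_span x : x \in span tensor_rel -> F x = 0.
Proof.
move=> xS; apply/eqP; have : x \in [pred y | F y == 0]; last by [].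
apply: (span_min _ _ xS) => {x xS}.
  split=> [|a x y]; rewrite !inE ?(lin0 F_linear) // F_linear.
  by move=> /eqP-> /eqP->; rewrite scaler0 addr0.
have FB x y : F (x - y) = F x - F y by exact: (raddfB (mklin F_linear)).
have Fg v w : F (gen v w) = f v w by rewrite /F liftU scale1r.
by move=> x [] [a [v [v' [w ->]]]];
   rewrite inE FB F_linear !Fg (hf.1, hf.2) subrr.
Qed.

Lemma tliftE v w : tlift f (tens v w) = f v w.
Proof.
rewrite /tlift -/F -[RHS]scale1r -[RHS](liftU (fun p => f p.1 p.2) 1 (v, w)).
rewrite -/F; apply/eqP; rewrite -subr_eq0.
rewrite -[_ - _](raddfB (mklin F_linear)) /=; apply/eqP/F_span.
by rewrite -(mqpi_eq (span_submod_closed _)) mqreprK.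
Qed.

Lemma tlift_linear : linear (tlift f).
Proof.
move=> a x y; rewrite /tlift -/F -F_linear; apply/eqP; rewrite -subr_eq0.
rewrite -[_ - _](raddfB (mklin F_linear)) /=; apply/eqP/F_span.
rewrite -(mqpi_eq (span_submod_closed _)). 
by rewrite linearP /= !mqreprK.
Qed.

End Lift.

End Tensor.

Arguments tensor {K} (V W)%_type_scope.

Notation "V ⊗ W" := (tensor V W) (at level 40, left associativity) : type_scope.
Notation "v ⊗ w" := (tens v w) (at level 40, left associativity) : ring_scope.

Section TensorMaps.
Variable K : fieldType.

Definition tmap (V V' W W' : lmodType K) (f : V -> V') (g : W -> W') :
    V ⊗ W -> V' ⊗ W' :=
  tlift (fun v w => f v ⊗ g w).

Definition tassoc (V W X : lmodType K) : (V ⊗ W) ⊗ X -> V ⊗ (W ⊗ X) :=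
  tlift (fun t x => tlift (fun v w => v ⊗ (w ⊗ x)) t).

Lemma bilin_comp (V V' W W' U U' : lmodType K) (b : V' -> W' -> U)
    (h : U -> U') (f : V -> V') (g : W -> W') :
  bilinear_map b -> linear h -> linear f -> linear g ->
  bilinear_map (fun v w => h (b (f v) (g w))).
Proof.
move=> [bl br] hh hf hg; split=> [w a x y | v a x y].
  by rewrite hf [b _ _]bl hh.
by rewrite hg br hh.
Qed.

Lemma tmap_bilin (V V' W W' : lmodType K) (f : V -> V') (g : W -> W') :
  linear f -> linear g -> bilinear_map (fun v w => f v ⊗ g w).
Proof.
move=> hf hg.
exact: (bilin_comp (h := id) (tens_bilinear _ _) (fun _ _ _ => erefl) hf hg).
Qed.

Lemma tmap_linear (V V' W W' : lmodType K) (f : V -> V') (g : W -> W') :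
  linear f -> linear g -> linear (tmap f g).
Proof. by move=> hf hg; exact/tlift_linear/tmap_bilin. Qed.

Lemma tmapE (V V' W W' : lmodType K) (f : V -> V') (g : W -> W') v w :
  linear f -> linear g -> tmap f g (v ⊗ w) = f v ⊗ g w.
Proof. by move=> hf hg; rewrite /tmap tliftE //; exact: tmap_bilin. Qed.

Lemma scaler_swap (V : lmodType K) a b (x y z t : V) :
  b *: (a *: x + y) + (a *: z + t) = a *: (b *: x + z) + (b *: y + t).
Proof. by rewrite !scalerDr !scalerA mulrC addrACA. Qed.

Section Assoc.
Variables V W X : lmodType K.

Let inner_bilin (x : X) : bilinear_map (fun (v : V) (w : W) => v ⊗ (w ⊗ x)).
Proof.
exact: (tmap_bilin (fun _ _ _ => erefl) ((tens_bilinear W X).1 x)).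
Qed.

Let outer_bilin :
  bilinear_map (fun (t : V ⊗ W) (x : X) => tlift (fun (v : V) (w : W) => v ⊗ (w ⊗ x)) t).
Proof.
split=> [x | t a x y]; first exact: (tlift_linear (inner_bilin x)).
elim/tensor_ind: t => [v w | b s t hs ht]; rewrite ?tliftE //.
  by rewrite !(tens_bilinear _ _).2.
rewrite !(tlift_linear (inner_bilin _)) hs ht.
exact: scaler_swap.
Qed.

Lemma tassoc_linear : linear (@tassoc V W X).
Proof. exact: tlift_linear outer_bilin. Qed.

Lemma tassocE v w x : tassoc (v ⊗ w ⊗ x) = (v : V) ⊗ ((w : W) ⊗ (x : X)).
Proof. by rewrite /tassoc !tliftE. Qed.

End Assoc.

End TensorMaps.

(* * Tensor powers *)

Section TensorPowers.
Variables (K : fieldType) (C : lmodType K).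

(* [tpow 2] is convertible to [C ⊗ C]. *)
Fixpoint tpow (n : nat) : lmodType K :=
  match n with
  | 0 => K^o
  | 1 => C
  | (_.+1 as m).+1 => (C ⊗ tpow m : Type)
  end.

Definition tcons (n : nat) : C -> tpow n -> tpow n.+1 :=
  match n with
  | 0 => fun c (k : K^o) => k *: c
  | _.+1 => fun c x => c ⊗ x
  end.

Definition tcons_lift (U : lmodType K) (n : nat) :
    (C -> tpow n -> U) -> tpow n.+1 -> U :=
  match n with
  | 0 => fun f c => f c (1 : K^o)
  | _.+1 => fun f => tlift f
  end.

(* The identification C^{⊗p} ⊗ C^{⊗q} = C^{⊗(p+q)}. *)
Fixpoint tcat (p q : nat) : tpow p -> tpow q -> tpow (p + q) :=
  match p with
  | 0 => fun (k : K^o) y => k *: y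
  | _.+1 => fun x y => tcons_lift (fun c x' => tcons c (tcat x' y)) x
  end.

(* f^{⊗n} *)
Fixpoint tpowmap (f : C -> C) (n : nat) : tpow n -> tpow n :=
  match n with
  | 0 => id
  | _.+1 => tcons_lift (fun c x => tcons (f c) (tpowmap f x))
  end.

(* b^{⊗p} ⊗ f ⊗ b^{⊗q} *)
Fixpoint tinsert (b : C -> C) (n : nat) (f : C -> tpow n) (p q : nat) :
    tpow (p + q.+1) -> tpow (p + (n + q)) :=
  match p with
  | 0 => tcons_lift (fun c y => tcat (f c) (tpowmap b y))
  | _.+1 => tcons_lift (fun c x => tcons (b c) (tinsert b f x))
  end.

Definition tcast (m n : nat) (e : m = n) (x : tpow m) : tpow n :=
  ecast k (tpow k) e x.

Lemma tcons_bilinear n : bilinear_map (@tcons n).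
Proof.
case: n => [|n]; last exact: tens_bilinear.
split=> [k a x y | c a x y] /=; first by rewrite scalerDr !scalerA mulrC.
by rewrite scalerDl scalerA.
Qed.

Lemma tpow_ind n (P : tpow n.+1 -> Prop) :
  (forall c x, P (tcons c x)) ->
  (forall a x y, P x -> P y -> P (a *: x + y)) -> forall t, P t.
Proof.
case: n P => [|n] P Pc PD t; last exact: tensor_ind.
by have := Pc t 1; rewrite /= scale1r.
Qed.

Section TconsLift.
Variables (U : lmodType K) (n : nat) (f : C -> tpow n -> U).
Hypothesis hf : bilinear_map f.

Lemma tcons_liftE c x : tcons_lift f (tcons c x) = f c x.
Proof.
case: n f hf x => [|m] g hg x /=; last exact: tliftE.
by rewrite (linZ (hg.1 1)) -(linZ (hg.2 c)) [_ *: _]mulr1.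
Qed.

Lemma tcons_lift_linear : linear (tcons_lift f).
Proof. by case: n f hf => [|m] g hg /=; [exact: hg.1 | exact: tlift_linear]. Qed.
End TconsLift.

Lemma tcons_bilin n n' (f : C -> C) (g : tpow n -> tpow n') :
  linear f -> linear g -> bilinear_map (fun c x => tcons (f c) (g x)).
Proof.
move=> hf hg.
exact: (bilin_comp (h := id) (@tcons_bilinear n') (fun _ _ _ => erefl) hf hg).
Qed.

Lemma tcat_bilinear p q : bilinear_map (@tcat p q).
Proof.
elim: p => [|p IHp].
  by split=> [y a x x' | x a y y'] /=;
    rewrite ?scalerDl ?scalerDr !scalerA // mulrC.
have bil y : bilinear_map (fun c x' => tcons c (@tcat p q x' y)).
  by apply: tcons_bilin => //; apply: IHp.1.
split=> [y | x a y y'] /=; first exact: tcons_lift_linear (bil y).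
elim/tpow_ind: x => [c x | b s t hs ht].
  by rewrite !tcons_liftE // IHp.2 (tcons_bilinear _).2.
rewrite !(tcons_lift_linear (bil _)) hs ht.
exact: scaler_swap.
Qed.

Lemma tcat_cons p q c (x : tpow p) (y : tpow q) :
  tcat (tcons c x) y = tcons c (tcat x y).
Proof.
rewrite /= (tcons_liftE (f := fun c x' => tcons c (tcat x' y))) //.
by apply: tcons_bilin => //; apply: (tcat_bilinear p q).1.
Qed.

Section Linear.
Variables (b : C -> C) (hb : linear b).

Lemma tpowmap_linear n : linear (tpowmap b (n := n)).
Proof. by elim: n => [|n IHn] //=; exact/tcons_lift_linear/tcons_bilin. Qed.

Lemma tpowmap_cons n c (x : tpow n) :
  tpowmap b (tcons c x) = tcons (b c) (tpowmap b x).
Proof. by rewrite /= tcons_liftE //; exact/tcons_bilin/tpowmap_linear. Qed.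

Lemma tpowmap_cat p q (x : tpow p) (y : tpow q) :
  tpowmap b (tcat x y) = tcat (tpowmap b x) (tpowmap b y).
Proof.
elim: p x => [|p IHp] x; first by rewrite /= (linZ (@tpowmap_linear q)).
elim/tpow_ind: x => [c x | a s t hs ht].
  by rewrite tcat_cons !tpowmap_cons tcat_cons IHp.
have hl := (tcat_bilinear p.+1 q).1; have hp := @tpowmap_linear.
by rewrite [tcat _ y]hl !hp hs ht [RHS]hl.
Qed.

Section Insert.
Variables (n : nat) (f : C -> tpow n) (hf : linear f).

Let insert0_bilin q :
  bilinear_map (fun c (y : tpow q) => tcat (f c) (tpowmap b y)).
Proof.
exact: (bilin_comp (h := id) (tcat_bilinear n q) (fun _ _ _ => erefl) hf
  (@tpowmap_linear q)).
Qed.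

Lemma tinsert_linear p q : linear (tinsert b f (p := p) (q := q)).
Proof.
elim: p => [|p IHp] /=; apply: tcons_lift_linear; first exact: insert0_bilin.
exact: tcons_bilin.
Qed.

Lemma tinsert_cons p q c (x : tpow (p + q.+1)) :
  tinsert b f (p := p.+1) (tcons c x) = tcons (b c) (tinsert b f x).
Proof. by rewrite /= tcons_liftE //; exact/tcons_bilin/tinsert_linear. Qed.

Lemma tinsert0_cons q c (y : tpow q) :
  tinsert b f (p := 0) (tcons c y) = tcat (f c) (tpowmap b y).
Proof. by rewrite /= tcons_liftE. Qed.

Lemma tinsertE p q (x : tpow p) c (y : tpow q) :
  tinsert b f (tcat x (tcons c y)) =
  tcat (tpowmap b x) (tcat (f c) (tpowmap b y)).
Proof.
elim: p x => [|p IHp] x.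
  by rewrite [tcat x _]/= (linZ (@tinsert_linear 0 q)) tinsert0_cons.
elim/tpow_ind: x => [c' x | a s t hs ht].
  by rewrite tcat_cons tinsert_cons tpowmap_cons tcat_cons IHp.
have hl r := (tcat_bilinear p.+1 r).1; have hp := @tpowmap_linear.
by rewrite [tcat _ (tcons c y)]hl tinsert_linear !hp hs ht [RHS]hl.
Qed.

End Insert.

Lemma tinsertP n (f g : C -> tpow n) a p q (x : tpow (p + q.+1)) :
  linear f -> linear g ->
  tinsert b (fun c => a *: f c + g c) x =
  a *: tinsert b f x + tinsert b g x.
Proof.
move=> hf hg; have hh : linear (fun c => a *: f c + g c).
  by move=> k u v; rewrite hf hg; apply: scaler_swap.
elim: p x => [|p IHp] x; elim/tpow_ind: x => [c x | k s t hs ht].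
- by rewrite !tinsert0_cons // (tcat_bilinear _ _).1.
- by rewrite !tinsert_linear // hs ht; apply: scaler_swap.
- by rewrite !tinsert_cons // IHp (tcons_bilinear _).2.
- by rewrite !tinsert_linear // hs ht; apply: scaler_swap.
Qed.

End Linear.

Section Natural.
Variables (b b' : C -> C) (hb : linear b) (hb' : linear b').
Hypothesis bb' : forall c, b (b' c) = b' (b c).

Lemma tpowmap_comm n (x : tpow n) :
  tpowmap b (tpowmap b' x) = tpowmap b' (tpowmap b x).
Proof.
elim: n x => [//|n IHn]; elim/tpow_ind => [c x|a s t hs ht].
  by rewrite !tpowmap_cons // IHn bb'.
have h := @tpowmap_linear b hb; have h' := @tpowmap_linear b' hb'.
by rewrite h' !h h' hs ht.
Qed.

Lemma tpowmap_insert n (f : C -> tpow n) p q (x : tpow (p + q.+1)) :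
  linear f -> (forall c, tpowmap b (f c) = f (b c)) ->
  tpowmap b (tinsert b' f x) = tinsert b' f (tpowmap b x).
Proof.
move=> hf bf; have h := @tpowmap_linear b hb.
elim: p x => [|p IHp] x; elim/tpow_ind: x => [c x | k s t hs ht].
- rewrite tpowmap_cons // !tinsert0_cons // [LHS]tpowmap_cat //.
  by rewrite bf tpowmap_comm.
- by rewrite tinsert_linear // !h hs ht [RHS]tinsert_linear.
- by rewrite tpowmap_cons // !tinsert_cons // tpowmap_cons // bb' IHp.
- by rewrite tinsert_linear // !h hs ht [RHS]tinsert_linear.
Qed.

End Natural.

Lemma tcast_linear m n (e : m = n) : linear (tcast e).
Proof. by case: n / e. Qed.

Lemma tpowmap_cast (b : C -> C) m n (e : m = n) (x : tpow m) :
  tpowmap b (tcast e x) = tcast e (tpowmap b x).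
Proof. by case: n / e. Qed.

End TensorPowers.

(* * Multiplicative hom-dendriform coalgebras *)

Record homDendCoalg (K : fieldType) := HomDendCoalg {
  hdc_space :> lmodType K;
  hdc_alpha : {linear hdc_space -> hdc_space};
  hdc_prec : {linear hdc_space -> (hdc_space ⊗ hdc_space)%type};
  hdc_succ : {linear hdc_space -> (hdc_space ⊗ hdc_space)%type};
  hdc_axiom1 : forall c,
    tassoc (tmap hdc_prec hdc_alpha (hdc_prec c)) =
    tmap hdc_alpha (hdc_prec \+ hdc_succ) (hdc_prec c);
  hdc_axiom2 : forall c,
    tassoc (tmap hdc_succ hdc_alpha (hdc_prec c)) =
    tmap hdc_alpha hdc_prec (hdc_succ c);
  hdc_axiom3 : forall c,
    tassoc (tmap (hdc_prec \+ hdc_succ) hdc_alpha (hdc_succ c)) =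
    tmap hdc_alpha hdc_succ (hdc_succ c);
  hdc_mult_prec : forall c,
    tmap hdc_alpha hdc_alpha (hdc_prec c) = hdc_prec (hdc_alpha c);
  hdc_mult_succ : forall c,
    tmap hdc_alpha hdc_alpha (hdc_succ c) = hdc_succ (hdc_alpha c)
}.

(* * The cochain complex; the labels [1], ..., [n] are indexed by 'I_n, so all
   indices are shifted by one with respect to the usual formulas. *)

Section Cohomology.
Variables (K : fieldType) (C : homDendCoalg K).
Local Notation alpha := (hdc_alpha C).

Definition label (n : nat) (r : 'I_n) : 'rV[K]_n := delta_mx 0 r.

Definition cochain_pred (n : nat) : {pred (tensor 'rV[K]_n C -> tpow C n)} :=
  fun s => `[< linear s /\
    forall r c, tpowmap alpha (s (label r ⊗ c)) = s (label r ⊗ alpha c) >].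

Lemma cochain_submod_closed n : submod_closed (@cochain_pred n).
Proof.
split=> [|a s t /asboolP[sl sa] /asboolP[tl ta]]; apply/asboolP; split.
- by move=> a x y; rewrite /= scaler0 addr0.
- by move=> r c; rewrite (lin0 (@tpowmap_linear _ _ _ (lin_fun alpha) n)).
- move=> b x y; rewrite -[LHS]/(a *: s _ + t _) sl tl.
  exact: scaler_swap.
- move=> r c; rewrite -[LHS]/(tpowmap _ (a *: s _ + t _)) tpowmap_linear.
    by rewrite sa ta.
  exact: lin_fun.
Qed.

HB.instance Definition _ n :=
  GRing.isSubmodClosed.Build K ('rV[K]_n ⊗ C -> tpow C n) (@cochain_pred n)
    (GRing.submod_closed_semi (@cochain_submod_closed n)).

Record cochain (n : nat) : Type := Cochain {
  cochain_fun :> 'rV[K]_n ⊗ C -> tpow C n;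
  cochain_mem : cochain_fun \in @cochain_pred n
}.

HB.instance Definition _ n := [isSub for @cochain_fun n].
HB.instance Definition _ n := [Choice of cochain n by <:].
HB.instance Definition _ n := [SubChoice_isSubLmodule of cochain n by <:].

Lemma cochain_linear n (s : cochain n) : linear s.
Proof. by case/asboolP: (cochain_mem s). Qed.

Lemma cochain_alpha n (s : cochain n) r c :
  tpowmap alpha (s (label r ⊗ c)) = s (label r ⊗ alpha c).
Proof. by case/asboolP: (cochain_mem s). Qed.

Lemma cochainP n a (s t : cochain n) x : (a *: s + t) x = a *: s x + t x.
Proof. by rewrite -[cochain_fun _]/(val _) linearP. Qed.

Lemma cochain_lin1 n (s : cochain n) x : linear (fun c => s (x ⊗ c)).
Proof.
move=> a c d; rewrite (tens_bilinear _ _).2; exact: cochain_linear.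
Qed.

Lemma cochain_ext n (s t : cochain n) :
  (forall r c, s (label r ⊗ c) = t (label r ⊗ c)) -> s = t.
Proof.
move=> st; apply/val_inj/funext; apply: tensor_ext => [||x c];
  try exact: cochain_linear.
have h (u : cochain n) :
    u (x ⊗ c) = \sum_(r < n) x 0 r *: u (label r ⊗ c).
  have hl : linear (fun y : 'rV[K]_n => u (y ⊗ c)).
    move=> a y z; rewrite ((tens_bilinear _ _).1 c); exact: cochain_linear.
  rewrite {1}[x]row_sum_delta (lin_sum _ _ hl).
  by apply: eq_bigr => r _; rewrite (linZ hl).
rewrite -[LHS]/(s (x ⊗ c)) -[RHS]/(t (x ⊗ c)) !h.
by apply: eq_bigr => r _; rewrite st.
Qed.

Section OnLabels.
Variables (n : nat) (f : 'I_n -> C -> tpow C n).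

Definition on_labels : 'rV[K]_n ⊗ C -> tpow C n :=
  tlift (fun (x : 'rV[K]_n) (c : C) => \sum_(r < n) x 0 r *: f r c).

Hypothesis f_lin : forall r, linear (f r).

Let on_labels_bilin :
  bilinear_map (fun (x : 'rV[K]_n) (c : C) => \sum_(r < n) x 0 r *: f r c).
Proof.
split=> [c a x y | x a c d] /=; rewrite [X in _ = X + _]scaler_sumr -big_split /=.
  by apply: eq_bigr => r _; rewrite !mxE scalerDl scalerA.
by apply: eq_bigr => r _; rewrite f_lin scalerDr !scalerA mulrC.
Qed.

Lemma on_labels_linear : linear on_labels.
Proof. exact: tlift_linear. Qed.

Lemma on_labelsE r c : on_labels (label r ⊗ c) = f r c.
Proof.
rewrite /on_labels tliftE // (bigD1 r) //= big1 ?addr0 => [|j jr].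
  by rewrite mxE !eqxx scale1r.
by rewrite mxE (negPf jr) andbF scale0r.
Qed.

Lemma on_labels_mem :
  (forall r c, tpowmap alpha (f r c) = f r (alpha c)) ->
  on_labels \in @cochain_pred n.
Proof.
move=> fa; apply/asboolP; split; first exact: on_labels_linear.
by move=> r c; rewrite !on_labelsE.
Qed.
End OnLabels.

Section PartialComposition.
Variables m n : nat.

Lemma R0_subproof (i : 'I_m) (r : 'I_(m + n).-1) :
  ((if r < i then r : nat else if r < i + n then i : nat else r.+1 - n) < m)%N.
Proof.
have im := ltn_ord i; have rm := ltn_ord r.
case: (ltnP r i) => [ri|_]; first exact: ltn_trans ri im.
case: (ltnP r (i + n)) => // inr.
have nr : (n <= r.+1)%N by apply: leq_trans (leqW inr); rewrite leq_addl.
have mn : (0 < m + n)%N by rewrite addn_gt0 (leq_ltn_trans (leq0n i) im).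
by rewrite -(ltn_add2r n) subnK //; move: rm; rewrite -ltnS prednK.
Qed.

Definition R0 (i : 'I_m) (r : 'I_(m + n).-1) : 'I_m :=
  Ordinal (R0_subproof i r).

Definition Ri (i : 'I_m) (r : 'I_(m + n).-1) : 'rV[K]_n :=
  if (i <= r < i + n)%N then \sum_(j < n | nat_of_ord r == (i + j)%N) label j
  else \sum_(j < n) label j.

Lemma split_in (i : 'I_m) : m = (i + (m - i.+1).+1)%N.
Proof. by rewrite subnSK // subnKC // ltnW. Qed.

Lemma split_out (i : 'I_m) : (i + (n + (m - i.+1)))%N = (m + n).-1.
Proof.
have h a k : m = (a + k.+1)%N -> (a + (n + k))%N = (m + n).-1.
  by move=> ->; rewrite -addnA addSn addnS /= [(k + n)%N]addnC.
exact: h (split_in i).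
Qed.

Definition pcomp_fun (s : cochain m) (t : cochain n) (i : 'I_m) :
    'rV[K]_(m + n).-1 ⊗ C -> tpow C (m + n).-1 :=
  on_labels (fun r c =>
    tcast (split_out i)
      (tinsert (iter n.-1 alpha) (fun d => t (Ri i r ⊗ d))
        (tcast (split_in i) (s (label (R0 i r) ⊗ c))))).

Variables (s : cochain m) (t : cochain n) (i : 'I_m).

Let iter_linear k : linear (iter k alpha).
Proof.
elim: k => [//|k IHk] a x y /=; rewrite IHk; exact: linearP.
Qed.

Let pcomp_term_linear r : linear (fun c : C =>
  tcast (split_out i)
    (tinsert (iter n.-1 alpha) (fun d => t (Ri i r ⊗ d))
      (tcast (split_in i) (s (label (R0 i r) ⊗ c))))).
Proof.
move=> a c d; rewrite [s _](cochain_lin1 s _ a c d) tcast_linear.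
by rewrite tinsert_linear ?tcast_linear //; apply: cochain_lin1.
Qed.

Lemma pcomp_funE r c :
  pcomp_fun s t i (label r ⊗ c) =
  tcast (split_out i)
    (tinsert (iter n.-1 alpha) (fun d => t (Ri i r ⊗ d))
      (tcast (split_in i) (s (label (R0 i r) ⊗ c)))).
Proof. exact: on_labelsE. Qed.

Lemma cochain_alpha_sum k (u : cochain k) (P : pred 'I_k) c :
  tpowmap alpha (u ((\sum_(j | P j) label j) ⊗ c)) =
  u ((\sum_(j | P j) label j) ⊗ alpha c).
Proof.
have hl d : linear (fun y : 'rV[K]_k => u (y ⊗ d)).
  move=> a y z; rewrite ((tens_bilinear _ _).1 d); exact: cochain_linear.
rewrite -!(big_filter _ P) (lin_sum _ _ (hl c)) (lin_sum _ _ (hl (alpha c))).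
rewrite (lin_sum _ _ (@tpowmap_linear _ _ _ (lin_fun alpha) k)).
by apply: eq_bigr => r _; rewrite cochain_alpha.
Qed.

Lemma pcomp_mem : pcomp_fun s t i \in @cochain_pred (m + n).-1.
Proof.
apply: on_labels_mem => [|r c]; first exact: pcomp_term_linear.
rewrite tpowmap_cast tpowmap_insert.
- by rewrite tpowmap_cast cochain_alpha.
- exact: lin_fun.
- exact: iter_linear.
- by move=> d; rewrite -iterSr.
- exact: cochain_lin1.
- by move=> d; rewrite /Ri; case: ifP => _; apply: cochain_alpha_sum.
Qed.

Definition pcomp : cochain (m + n).-1 := Cochain pcomp_mem.

End PartialComposition.

Lemma pcompP1 m n a (s s' : cochain m) (t : cochain n) i :
  pcomp (a *: s + s') t i = a *: pcomp s t i + pcomp s' t i.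
Proof.
apply: cochain_ext => r c; rewrite cochainP /= !pcomp_funE cochainP.
have hi : linear (iter n.-1 alpha).
  by elim: n.-1 => [//|k IHk] b x y /=; rewrite IHk; apply: linearP.
by rewrite tcast_linear tinsert_linear ?tcast_linear //; apply: cochain_lin1.
Qed.

Lemma pcompP2 m n a (s : cochain m) (t t' : cochain n) i :
  pcomp s (a *: t + t') i = a *: pcomp s t i + pcomp s t' i.
Proof.
apply: cochain_ext => r c; rewrite cochainP /= !pcomp_funE -tcast_linear.
have hi : linear (iter n.-1 alpha).
  by elim: n.-1 => [//|k IHk] b x y /=; rewrite IHk; apply: linearP.
by rewrite -tinsertP //; apply: cochain_lin1.
Qed.

Definition comp m n (s : cochain m) (t : cochain n) : cochain (m + n).-1 :=
  \sum_(i < m) (-1) ^+ (i * n.-1) *: pcomp s t i.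

Lemma compP1 m n a (s s' : cochain m) (t : cochain n) :
  comp (a *: s + s') t = a *: comp s t + comp s' t.
Proof.
rewrite /comp scaler_sumr -big_split /=; apply: eq_bigr => i _.
by rewrite pcompP1 scalerDr !scalerA mulrC.
Qed.

Lemma compP2 m n a (s : cochain m) (t t' : cochain n) :
  comp s (a *: t + t') = a *: comp s t + comp s t'.
Proof.
rewrite /comp scaler_sumr -big_split /=; apply: eq_bigr => i _.
by rewrite pcompP2 scalerDr !scalerA mulrC.
Qed.

Definition coproduct_fun : 'rV[K]_2 ⊗ C -> tpow C 2 :=
  on_labels (fun (r : 'I_2) c =>
    if r == ord0 then hdc_prec C c else hdc_succ C c).

Lemma tpowmap2 (b : C -> C) : linear b -> @tpowmap K C b 2 =1 tmap b b.
Proof.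
move=> hb; have h := @tpowmap_linear _ _ _ hb 2.
apply: (@tensor_ext K C C (C ⊗ C)%type _ _ h (tmap_linear hb hb)) => v w.
by rewrite tmapE // [LHS](tpowmap_cons hb) /= scale1r.
Qed.

Lemma coproduct_mem : coproduct_fun \in @cochain_pred 2.
Proof.
apply: on_labels_mem => r; first by case: (r == ord0); apply: lin_fun.
move=> c; rewrite tpowmap2; last exact: lin_fun.
by case: ifP => _; rewrite (hdc_mult_prec, hdc_mult_succ).
Qed.

Definition coproduct : cochain 2 := Cochain coproduct_mem.

Definition cochain_cast m n (e : m = n) (s : cochain m) : cochain n :=
  ecast k (cochain k) e s.

Lemma pred_addn2 n : (n + 2).-1 = n.+1.
Proof. by rewrite addn2. Qed.

Definition delta n (s : cochain n) : cochain n.+1 :=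
  comp coproduct s - (-1) ^+ n.-1 *: cochain_cast (pred_addn2 n) (comp s coproduct).

Lemma delta_is_linear n : linear (@delta n).
Proof.
move=> a s t; rewrite /delta compP1 compP2.
have -> u v : cochain_cast (pred_addn2 n) (a *: u + v) =
    a *: cochain_cast (pred_addn2 n) u + cochain_cast (pred_addn2 n) v.
  by case: _ / (pred_addn2 n).
by rewrite !scalerDr !scalerN opprD !scalerA mulrC addrACA.
Qed.

HB.instance Definition _ n :=
  GRing.isLinear.Build K (cochain n) (cochain n.+1) *:%R (@delta n)
    (@delta_is_linear n).

Definition cocycle_pred n : {pred cochain n} := fun s => delta s == 0.

Lemma cocycle_submod_closed n : submod_closed (@cocycle_pred n).
Proof.
split=> [|a s t]; rewrite !unfold_in ?raddf0 // => /eqP s0 /eqP t0.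
by rewrite linearP /= s0 t0 scaler0 addr0.
Qed.

HB.instance Definition _ n :=
  GRing.isSubmodClosed.Build K (cochain n) (@cocycle_pred n)
    (GRing.submod_closed_semi (@cocycle_submod_closed n)).

Record cocycle (n : nat) : Type := Cocycle {
  cocycle_cochain :> cochain n;
  cocycle_mem : cocycle_cochain \in @cocycle_pred n
}.

HB.instance Definition _ n := [isSub for @cocycle_cochain n].
HB.instance Definition _ n := [Choice of cocycle n by <:].
HB.instance Definition _ n := [SubChoice_isSubLmodule of cocycle n by <:].

(* The cocycles that are coboundaries. *)
Definition coboundary_pred n : {pred cocycle n} :=
  match n with
  | 0 => fun z => z == 0
  | _.+1 => fun z => `[< exists s, delta s = cocycle_cochain z >]
  end.

Lemma coboundary_submod_closed n : submod_closed (@coboundary_pred n).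
Proof.
case: n => [|n]; split=> [|a x y]; rewrite !unfold_in ?eqxx //=.
- by move=> /eqP-> /eqP->; rewrite scaler0 addr0.
- by apply/asboolP; exists 0; rewrite !raddf0.
- move=> /asboolP[s sx] /asboolP[t ty]; apply/asboolP; exists (a *: s + t).
  by rewrite !linearP /= sx ty.
Qed.

Definition cohomology (n : nat) : Type :=
  modquot (@coboundary_submod_closed n).
HB.instance Definition _ n := GRing.Lmodule.on (cohomology n).

End Cohomology.

(* * Formal deformations *)

Section Deformations.
Variables (K : fieldType) (C : homDendCoalg K).
Local Notation alpha := (hdc_alpha C).

Record deformation := Deformation {
  def_prec : nat -> {linear C -> (C ⊗ C)%type};
  def_succ : nat -> {linear C -> (C ⊗ C)%type};
  def_prec0 : def_prec 0 =1 hdc_prec C;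
  def_succ0 : def_succ 0 =1 hdc_succ C;
  def_mult_prec : forall i c,
    tmap alpha alpha (def_prec i c) = def_prec i (alpha c);
  def_mult_succ : forall i c,
    tmap alpha alpha (def_succ i c) = def_succ i (alpha c);
  def_axiom1 : forall n c,
    \sum_(i < n.+1) tassoc (tmap (def_prec i) alpha (def_prec (n - i) c)) =
    \sum_(i < n.+1) tmap alpha (def_prec i \+ def_succ i) (def_prec (n - i) c);
  def_axiom2 : forall n c,
    \sum_(i < n.+1) tassoc (tmap (def_succ i) alpha (def_prec (n - i) c)) =
    \sum_(i < n.+1) tmap alpha (def_prec i) (def_succ (n - i) c);
  def_axiom3 : forall n c,
    \sum_(i < n.+1)
      tassoc (tmap (def_prec i \+ def_succ i) alpha (def_succ (n - i) c)) =
    \sum_(i < n.+1) tmap alpha (def_succ i) (def_succ (n - i) c)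
}.

Definition equivalent (D D' : deformation) : Prop :=
  exists Phi : nat -> {linear C -> C},
    [/\ Phi 0 =1 id,
        forall i c, Phi i (alpha c) = alpha (Phi i c),
        forall n c,
          \sum_(i < n.+1) def_prec D' i (Phi (n - i)%N c) =
          \sum_(k < n.+1) \sum_(i < (n - k).+1)
            tmap (Phi i) (Phi (n - k - i)%N) (def_prec D k c)
      & forall n c,
          \sum_(i < n.+1) def_succ D' i (Phi (n - i)%N c) =
          \sum_(k < n.+1) \sum_(i < (n - k).+1)
            tmap (Phi i) (Phi (n - k - i)%N) (def_succ D k c)].

Definition const_coef (f : {linear C -> (C ⊗ C)%type}) (i : nat) :
    {linear C -> (C ⊗ C)%type} :=
  if i is 0 then f else \0.

Section ConstSum.
Variables (V W : lmodType K) (G : nat -> V -> W) (f : nat -> C -> V).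
Hypothesis G_lin : linear (G 0%N).
Hypothesis G0 : forall i x, G i.+1 x = 0.
Hypothesis f0 : forall i c, f i.+1 c = 0.

Lemma const_sum n c :
  \sum_(i < n.+1) G i (f (n - i)%N c) = if n is 0 then G 0%N (f 0%N c) else 0.
Proof.
rewrite big_ord_recl /= subn0 big1 ?addr0 => [|i _]; last by rewrite G0.
by case: n => // n; rewrite f0 lin0.
Qed.
End ConstSum.

Lemma tmap0l (V V' W W' : lmodType K) (f : V -> V') (g : W -> W') t :
  linear g -> (forall v, f v = 0) -> tmap f g t = 0.
Proof.
move=> hg f0; have hf : linear f by move=> a x y; rewrite !f0 scaler0 addr0.
elim/tensor_ind: t => [v w|a x y hx hy].
  by rewrite tmapE // f0 (lin0 ((tens_bilinear V' W').1 _)).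
by rewrite tmap_linear // hx hy scaler0 addr0.
Qed.

Lemma tmap0r (V V' W W' : lmodType K) (f : V -> V') (g : W -> W') t :
  linear f -> (forall w, g w = 0) -> tmap f g t = 0.
Proof.
move=> hf g0; have hg : linear g by move=> a x y; rewrite !g0 scaler0 addr0.
elim/tensor_ind: t => [v w|a x y hx hy].
  by rewrite tmapE // g0 (lin0 ((tens_bilinear V' W').2 _)).
by rewrite tmap_linear // hx hy scaler0 addr0.
Qed.

Local Notation cp := (const_coef (hdc_prec C)).
Local Notation cs := (const_coef (hdc_succ C)).

Lemma const_mult (f : {linear C -> (C ⊗ C)%type}) : (forall c, tmap alpha alpha (f c) = f (alpha c)) ->
  forall i c, tmap alpha alpha (const_coef f i c) = const_coef f i (alpha c).
Proof.
move=> h [|i] c /=; first exact: h.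
by rewrite (lin0 (tmap_linear (lin_fun alpha) (lin_fun alpha))).
Qed.

Lemma const_suml (f : nat -> {linear C -> (C ⊗ C)%type})
    (g : {linear C -> (C ⊗ C)%type}) n c :
  (forall i x, f i.+1 x = 0) ->
  \sum_(i < n.+1) tassoc (tmap (f i) alpha (const_coef g (n - i) c)) =
  if n is 0 then tassoc (tmap (f 0%N) alpha (g c)) else 0.
Proof.
move=> f0; have hl i : linear (fun x : C ⊗ C => tassoc (tmap (f i) alpha x)).
  by apply: lin_comp; [exact: tassoc_linear | exact: tmap_linear (lin_fun _) (lin_fun _)].
apply: (const_sum (G := fun i x => tassoc (tmap (f i) alpha x))
  (f := fun i d => const_coef g i d)) => // i x.
by rewrite tmap0l ?(lin0 (@tassoc_linear _ _ _ _)) //; apply: lin_fun.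
Qed.

Lemma const_sumr (f : nat -> {linear C -> (C ⊗ C)%type})
    (g : {linear C -> (C ⊗ C)%type}) n c :
  (forall i x, f i.+1 x = 0) ->
  \sum_(i < n.+1) tmap alpha (f i) (const_coef g (n - i) c) =
  if n is 0 then tmap alpha (f 0%N) (g c) else 0.
Proof.
move=> f0; apply: (const_sum (G := fun i x => tmap alpha (f i) x)
  (f := fun i d => const_coef g i d)) => // [|i x].
  exact: tmap_linear (lin_fun _) (lin_fun _).
by rewrite tmap0r //; apply: lin_fun.
Qed.

Let const_axiom1 n c :
  \sum_(i < n.+1) tassoc (tmap (cp i) alpha (cp (n - i) c)) =
  \sum_(i < n.+1) tmap alpha (cp i \+ cs i) (cp (n - i) c).
Proof.
rewrite const_suml // (const_sumr (f := fun i => cp i \+ cs i)).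
  by case: n => // ; apply: hdc_axiom1.
by move=> i x /=; rewrite addr0.
Qed.

Let const_axiom2 n c :
  \sum_(i < n.+1) tassoc (tmap (cs i) alpha (cp (n - i) c)) =
  \sum_(i < n.+1) tmap alpha (cp i) (cs (n - i) c).
Proof.
by rewrite const_suml // const_sumr //; case: n => //; apply: hdc_axiom2.
Qed.

Let const_axiom3 n c :
  \sum_(i < n.+1) tassoc (tmap (cp i \+ cs i) alpha (cs (n - i) c)) =
  \sum_(i < n.+1) tmap alpha (cs i) (cs (n - i) c).
Proof.
rewrite (const_suml (f := fun i => cp i \+ cs i)) => [|i x /=]; last first.
  by rewrite addr0.
by rewrite const_sumr //; case: n => //; apply: hdc_axiom3.
Qed.

Definition const_deformation : deformation :=
  Deformation (def_prec := cp) (def_succ := cs)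
    (fun=> erefl) (fun=> erefl)
    (const_mult (@hdc_mult_prec K C)) (const_mult (@hdc_mult_succ K C))
    const_axiom1 const_axiom2 const_axiom3.

Definition trivial_deformation (D : deformation) : Prop :=
  equivalent D const_deformation.

End Deformations.

(* Main.v *)
(* A trivialization of the deformation D is a family Phi with Phi_0 = id,
   commuting with alpha, such that △_* Phi_t = (Phi_t ⊗ Phi_t) D_*. It is built
   one coefficient at a time. If the equation holds below order n, then the
   truncated coproduct △_* + t^n E_*, with E_* the error at order n, is
   intertwined with D_* by Phi up to order n. The three axioms of D are
   therefore transported to it through order n, and at order n they say exactly
   that (E_prec, E_succ) is a 2-cocycle. As H^2 = 0 it is delta f, and replacing
   Phi_n by Phi_n - f makes the equation hold at order n. *)

Require Import Defs.
From mathcomp Require Import all_boot all_order all_algebra.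
From mathcomp Require Import boolp.
Import Defs.

Set Implicit Arguments.
Unset Strict Implicit.
Unset Printing Implicit Defensive.

Import GRing.Theory.
Local Open Scope ring_scope.

(** * Cauchy products as sums over antidiagonals *)

Section AntidiagonalSums.
Variable U : nmodType.
Implicit Types f g : nat -> nat -> U.

(** This is the coefficient at t^n of a Cauchy product, indexed as in the deformation axioms so that
    those apply up to conversion. *)
Definition asum n f : U := \sum_(i < n.+1) f i (n - i)%N.

Lemma eq_asum n f g :
  (forall i j, (i + j = n)%N -> f i j = g i j) -> asum n f = asum n g.
Proof.
by move=> fg; apply: eq_bigr => i _; apply: fg; rewrite subnKC // -ltnS.
Qed.

Lemma asumC n f : asum n f = asum n (fun i j => f j i).
Proof.
rewrite /asum (reindex_inj rev_ord_inj); apply: eq_bigr => i _ /=.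
by rewrite subSS subKn // -ltnS.
Qed.

Lemma asum0 f : asum 0 f = f 0%N 0%N.
Proof. by rewrite /asum big_ord1. Qed.

Lemma asumSl n f : asum n.+1 f = f 0%N n.+1 + asum n (fun i j => f i.+1 j).
Proof. by rewrite /asum big_ord_recl. Qed.

Lemma asumSr n f : asum n.+1 f = asum n (fun i j => f i j.+1) + f n.+1 0%N.
Proof. by rewrite asumC asumSl addrC asumC. Qed.

Lemma asumD n f g : asum n (fun i j => f i j + g i j) = asum n f + asum n g.
Proof. exact: big_split. Qed.

Lemma asum_eq0 n f : (forall i j, (i + j = n)%N -> f i j = 0) -> asum n f = 0.
Proof. by move=> f0; rewrite /asum big1 // => i _; apply: f0; rewrite subnKC //
  -ltnS. Qed.

(** Both sides run over triples with total n, grouped by the first index or by the last: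
    associativity of the Cauchy product. *)
Lemma asumA n (f : nat -> nat -> nat -> U) :
  asum n (fun i j => asum j (f i)) =
  asum n (fun m l => asum m (fun i k => f i k l)).
Proof.
elim: n f => [|n IHn] f; first by rewrite !asum0.
rewrite asumSl IHn [RHS]asumSl asum0.
under [in RHS]eq_asum => m l _ do rewrite asumSl.
by rewrite asumD addrA -asumSl.
Qed.

Lemma asumAC n (f : nat -> nat -> nat -> U) :
  asum n (fun m l => asum m (fun i k => f i k l)) =
  asum n (fun m k => asum m (fun i l => f i k l)).
Proof. by rewrite -2!asumA; apply: eq_asum => i j _; exact: asumC. Qed.

(** Meant for series X_0 + t^n X_n: at order n only the two end terms remain, and [0 < n] keeps them
    distinct. *)
Lemma asum_ends n f : (0 < n)%N ->
  (forall i j, (0 < i < n)%N -> (i + j = n)%N -> f i j = 0) ->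
  asum n f = f 0%N n + f n 0%N.
Proof.
case: n => // n _ f0; rewrite asumSl; congr (_ + _).
case: n f0 => [|n] f0; first by rewrite asum0.
rewrite asumSr asum_eq0 ?add0r // => i j ij; apply: f0.
  by rewrite /= !ltnS -ij leq_addr.
by rewrite addSn addnS ij.
Qed.

Lemma asum_head n k f : (k < n)%N ->
  (forall i j, (0 < i < n)%N -> f i j = 0) -> asum k f = f 0%N k.
Proof.
case: k => [|k] kn f0; first by rewrite asum0.
rewrite asumSl asum_eq0 ?addr0 // => i j ij; apply: f0 => /=.
by apply: leq_ltn_trans kn; rewrite ltnS -ij leq_addr.
Qed.

End AntidiagonalSums.

Lemma asumB (U : zmodType) n (f g : nat -> nat -> U) :
  asum n (fun i j => f i j - g i j) = asum n f - asum n g.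
Proof. exact: sumrB. Qed.

Section LinearAsum.
Variables (K : fieldType) (V W : lmodType K).

Lemma lin_asum (L : V -> W) n f : linear L ->
  L (asum n f) = asum n (fun i j => L (f i j)).
Proof. by move=> hL; rewrite /asum (lin_sum _ _ hL). Qed.

Lemma asum_linear n (f : nat -> nat -> V -> W) :
  (forall i j, linear (f i j)) -> linear (fun x => asum n (fun i j => f i j x)).
Proof.
move=> hf a x y; rewrite /asum scaler_sumr -big_split /=.
by apply: eq_bigr => i _; rewrite hf.
Qed.

End LinearAsum.

(** * Functoriality and additivity of tensor products of linear maps *)

Section TensorMapLemmas.
Variable K : fieldType.

Lemma eq_tmap (V V' W W' : lmodType K) (f f' : V -> V') (g g' : W -> W') :
  f =1 f' -> g =1 g' -> tmap f g =1 tmap f' g'.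
Proof. by move=> /funext -> /funext ->. Qed.

Lemma tmap_comp (V V' V'' W W' W'' : lmodType K)
    (f : V -> V') (f' : V' -> V'') (g : W -> W') (g' : W' -> W'') :
  linear f -> linear f' -> linear g -> linear g' ->
  forall t, tmap f' g' (tmap f g t) = tmap (f' \o f) (g' \o g) t.
Proof.
move=> hf hf' hg hg'; apply: tensor_ext => [||v w].
- exact: lin_comp (tmap_linear hf' hg') (tmap_linear hf hg).
- exact: tmap_linear (lin_comp hf' hf) (lin_comp hg' hg).
- by rewrite !tmapE //; exact: lin_comp.
Qed.

Lemma tmap_id (V W : lmodType K) (t : (V ⊗ W)%type) : tmap id id t = t.
Proof.
have h (X : lmodType K) : linear (@id X) by [].
elim/tensor_ind: t => [v w|a x y hx hy]; first by rewrite tmapE.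
by rewrite (tmap_linear (h V) (h W)) hx hy.
Qed.

Lemma tmapPl (V V' W W' : lmodType K) a (f f' : V -> V') (g : W -> W') :
  linear f -> linear f' -> linear g -> forall t,
  tmap (fun x => a *: f x + f' x) g t = a *: tmap f g t + tmap f' g t.
Proof.
move=> hf hf' hg t; have hh : linear (fun x => a *: f x + f' x).
  by move=> k u v; rewrite hf hf'; apply: scaler_swap.
elim/tensor_ind: t => [v w|k s t hs ht].
  by rewrite !tmapE // (tens_bilinear _ _).1.
rewrite (tmap_linear hh hg) (tmap_linear hf hg) (tmap_linear hf' hg) hs ht.
by rewrite scaler_swap.
Qed.

Lemma tmapPr (V V' W W' : lmodType K) a (f : V -> V') (g g' : W -> W') :
  linear f -> linear g -> linear g' -> forall t,
  tmap f (fun x => a *: g x + g' x) t = a *: tmap f g t + tmap f g' t.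
Proof.
move=> hf hg hg' t; have hh : linear (fun x => a *: g x + g' x).
  by move=> k u v; rewrite hg hg'; apply: scaler_swap.
elim/tensor_ind: t => [v w|k s t hs ht].
  by rewrite !tmapE // (tens_bilinear _ _).2.
rewrite (tmap_linear hf hh) (tmap_linear hf hg) (tmap_linear hf hg') hs ht.
by rewrite scaler_swap.
Qed.

Lemma tmapDl (V V' W W' : lmodType K) (f f' : V -> V') (g : W -> W') t :
  linear f -> linear f' -> linear g ->
  tmap (f \+ f') g t = tmap f g t + tmap f' g t.
Proof.
move=> hf hf' hg; rewrite -[tmap f g t]scale1r -tmapPl //.
by apply: eq_tmap => // x /=; rewrite scale1r.
Qed.

Lemma tmapDr (V V' W W' : lmodType K) (f : V -> V') (g g' : W -> W') t :
  linear f -> linear g -> linear g' ->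
  tmap f (g \+ g') t = tmap f g t + tmap f g' t.
Proof.
move=> hf hg hg'; rewrite -[tmap f g t]scale1r -tmapPr //.
by apply: eq_tmap => // x /=; rewrite scale1r.
Qed.

Lemma tmap_asuml (V V' W W' : lmodType K) n (f : nat -> nat -> V -> V')
    (g : W -> W') t : (forall i j, linear (f i j)) -> linear g ->
  tmap (fun x => asum n (fun i j => f i j x)) g t =
  asum n (fun i j => tmap (f i j) g t).
Proof.
move=> hf hg; have hs := asum_linear n hf.
move: t; apply: tensor_ext; first exact: tmap_linear.
  by apply: asum_linear => i j; exact: tmap_linear.
move=> v w; rewrite tmapE //.
have h := (tens_bilinear V' W').1 (g w).
rewrite (lin_asum _ _ h); apply: eq_asum => i j _.
by rewrite tmapE.
Qed.

Lemma tmap_asumr (V V' W W' : lmodType K) n (f : V -> V')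
    (g : nat -> nat -> W -> W') t : linear f -> (forall i j, linear (g i j)) ->
  tmap f (fun x => asum n (fun i j => g i j x)) t =
  asum n (fun i j => tmap f (g i j) t).
Proof.
move=> hf hg; have hs := asum_linear n hg.
move: t; apply: tensor_ext; first exact: tmap_linear.
  by apply: asum_linear => i j; exact: tmap_linear.
move=> v w; rewrite tmapE //.
have h := (tens_bilinear V' W').2 (f v).
rewrite (lin_asum _ _ h); apply: eq_asum => i j _.
by rewrite tmapE.
Qed.

Lemma tensor3_ext (V W X U : lmodType K) (f g : ((V ⊗ W) ⊗ X)%type -> U) :
  linear f -> linear g ->
  (forall v w x, f (v ⊗ w ⊗ x) = g (v ⊗ w ⊗ x)) -> f =1 g.
Proof.
move=> hf hg fg; apply: tensor_ext => // t x; move: t.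
have hx := (tens_bilinear (V ⊗ W)%type X).1 x.
exact: (tensor_ext (lin_comp hf hx) (lin_comp hg hx) (fun v w => fg v w x)).
Qed.

Lemma tassoc_tmap (V V' W W' X X' : lmodType K)
    (f : V -> V') (g : W -> W') (h : X -> X') :
  linear f -> linear g -> linear h -> forall t,
  tassoc (tmap (tmap f g) h t) = tmap f (tmap g h) (tassoc t).
Proof.
move=> hf hg hh; have hfg := tmap_linear hf hg; have hgh := tmap_linear hg hh.
apply: tensor3_ext => [||v w x].
- exact: (lin_comp (@tassoc_linear _ _ _ _) (tmap_linear hfg hh)).
- exact: (lin_comp (tmap_linear hf hgh) (@tassoc_linear _ _ _ _)).
- by rewrite !(tmapE, tassocE).
Qed.

End TensorMapLemmas.

(** * Transport of quadratic identities along an intertwining series *)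

Section Transport.
Variables (K : fieldType) (C : lmodType K) (alpha : C -> C).
Hypothesis alpha_lin : linear alpha.
Variable Phi : nat -> C -> C.
Hypotheses (Phi_lin : forall i, linear (Phi i))
  (Phi_alpha : forall i c, Phi i (alpha c) = alpha (Phi i c)).
Implicit Types A B X : nat -> C -> (C ⊗ C)%type.

(** The coefficient at t^n of Phi_t ⊗ Phi_t; [tensor3_series] is that of Phi_t ⊗ (Phi_t ⊗ Phi_t). *)
Definition tensor_series n (t : (C ⊗ C)%type) : (C ⊗ C)%type :=
  asum n (fun i j => tmap (Phi i) (Phi j) t).

Definition tensor3_series n (t : (C ⊗ (C ⊗ C))%type) : (C ⊗ (C ⊗ C))%type :=
  asum n (fun i j => tmap (Phi i) (tensor_series j) t).

(** The identity X' Phi = (Phi ⊗ Phi) X of formal series, modulo t^{N+1}. *)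
Definition intertwined N X X' : Prop := forall k c, (k <= N)%N ->
  asum k (fun i j => X' i (Phi j c)) =
  asum k (fun i j => tensor_series i (X j c)).

(** Coefficients of (A ⊗ alpha) B, reassociated, and next of (alpha ⊗ A) B; each dendriform axiom
    equates one of each kind. *)
Definition left_comp A B n c : (C ⊗ (C ⊗ C))%type :=
  asum n (fun i j => tassoc (tmap (A i) alpha (B j c))).

Definition right_comp A B n c : (C ⊗ (C ⊗ C))%type :=
  asum n (fun i j => tmap alpha (A i) (B j c)).

Lemma tensor_series_linear n : linear (tensor_series n).
Proof. by apply: asum_linear => i j; exact: tmap_linear. Qed.

Lemma tensor3_series_linear n : linear (tensor3_series n).
Proof.
by apply: asum_linear => i j; apply: tmap_linear => //; exact:
  tensor_series_linear.
Qed.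

Lemma tensor3_seriesE n t : tensor3_series n t =
  asum n (fun i j => asum j (fun k l => tmap (Phi i) (tmap (Phi k) (Phi l)) t)).
Proof.
apply: eq_asum => i j _; rewrite -tmap_asumr // => k l.
exact: tmap_linear.
Qed.

Lemma intertwinedD N X X' Y Y' :
  intertwined N X X' -> intertwined N Y Y' ->
  intertwined N (fun i => X i \+ Y i) (fun i => X' i \+ Y' i).
Proof.
move=> hX hY k c kN; rewrite asumD hX // hY // -asumD.
by apply: eq_asum => i j _ /=; rewrite (linD (@tensor_series_linear i)).
Qed.

Variables (N : nat) (A A' B B' : nat -> C -> (C ⊗ C)%type).
Hypotheses (A_lin : forall i, linear (A i)) (A'_lin : forall i, linear (A' i)).
Hypotheses (AA' : intertwined N A A') (BB' : intertwined N B B').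

(** On the first factor Phi ⊗ Phi passes through [A'] by intertwining, on the second it commutes
    with [alpha]; naturality of the associator then brings all three copies of Phi outside. *)
Let left_step m (t : (C ⊗ C)%type) : (m <= N)%N ->
  asum m (fun a p => tassoc (tmap (A' a) alpha (tensor_series p t))) =
  asum m (fun i l => tensor3_series i (tassoc (tmap (A l) alpha t))).
Proof.
move=> mN.
have hl a : linear (fun y => tassoc (tmap (A' a) alpha y)).
  exact: (lin_comp (@tassoc_linear _ _ _ _) (tmap_linear _ _)).
(* For fixed v the pairs (a, u) fill one antidiagonal, to which the intertwining relation of [A]
   applies. *)
transitivity (asum m (fun k v => asum k (fun a u =>
    tassoc (tmap (A' a \o Phi u) (alpha \o Phi v) t)))).
  rewrite -asumA; apply: eq_asum => a p _.
  rewrite (lin_asum _ _ (hl a)); apply: eq_asum => u v _.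
  by rewrite tmap_comp.
transitivity (asum m (fun k v => asum k (fun p l => asum p (fun u w =>
    tmap (Phi u) (tmap (Phi w) (Phi v)) (tassoc (tmap (A l) alpha t)))))).
  apply: eq_asum => k v kv.
  have kN : (k <= N)%N by apply: leq_trans mN; rewrite -kv leq_addr.
  have hv : linear (alpha \o Phi v) by exact: lin_comp.
  have hAP a u : linear (A' a \o Phi u) by exact: lin_comp.
  rewrite -(lin_asum _ _ (@tassoc_linear _ _ _ _)) -(tmap_asuml _ t hAP hv).
  have E1 : (fun x => asum k (fun i j => (A' i \o Phi j) x)) =1
      (fun x => asum k (fun p l => (tensor_series p \o A l) x)).
    by move=> x; exact: AA'.
  have hTA p l : linear (tensor_series p \o A l).
    exact: (lin_comp (@tensor_series_linear p) (A_lin l)).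
  rewrite (eq_tmap E1 (frefl _)) tmap_asuml // (lin_asum _ _ (@tassoc_linear _
    _ _ _)).
  apply: eq_asum => p l _.
  have E2 : alpha \o Phi v =1 Phi v \o alpha by move=> x /=.
  rewrite (eq_tmap (frefl _) E2) -(tmap_comp (A_lin l) (@tensor_series_linear
    p)) //.
  rewrite tmap_asuml // => [|i j]; last exact: tmap_linear.
  rewrite (lin_asum _ _ (@tassoc_linear _ _ _ _)).
  by apply: eq_asum => u w _; rewrite tassoc_tmap.
rewrite asumAC; apply: eq_asum => i l _.
by rewrite tensor3_seriesE asumA.
Qed.

Let right_step m (t : (C ⊗ C)%type) : (m <= N)%N ->
  asum m (fun a p => tmap alpha (A' a) (tensor_series p t)) =
  asum m (fun i l => tensor3_series i (tmap alpha (A l) t)).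
Proof.
move=> mN.
have hl a : linear (tmap alpha (A' a)) by exact: tmap_linear.
(* Now [A'] acts on the second factor, so the sum is grouped by u, the index of Phi on the first. *)
transitivity (asum m (fun k u => asum k (fun a v =>
    tmap (alpha \o Phi u) (A' a \o Phi v) t))).
  rewrite asumAC -asumA; apply: eq_asum => a p _.
  rewrite (lin_asum _ _ (hl a)); apply: eq_asum => u v _.
  by rewrite tmap_comp.
transitivity (asum m (fun k u => asum k (fun p l =>
    tmap (Phi u) (tensor_series p) (tmap alpha (A l) t)))).
  apply: eq_asum => k u ku.
  have kN : (k <= N)%N by apply: leq_trans mN; rewrite -ku leq_addr.
  have hu : linear (alpha \o Phi u) by exact: lin_comp.
  have hAP a v : linear (A' a \o Phi v) by exact: lin_comp.
  rewrite -(tmap_asumr _ t hu hAP).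
  have E1 : (fun x => asum k (fun i j => (A' i \o Phi j) x)) =1
      (fun x => asum k (fun p l => (tensor_series p \o A l) x)).
    by move=> x; exact: AA'.
  have hTA p l : linear (tensor_series p \o A l).
    exact: (lin_comp (@tensor_series_linear p) (A_lin l)).
  rewrite (eq_tmap (frefl _) E1) tmap_asumr //.
  apply: eq_asum => p l _.
  have E2 : alpha \o Phi u =1 Phi u \o alpha by move=> x /=.
  rewrite (eq_tmap E2 (frefl _)) -(tmap_comp alpha_lin (Phi_lin u) (A_lin l))
    //.
  exact: tensor_series_linear.
by rewrite asumC asumA.
Qed.

(** Phi passes first through [B'] by intertwining, then through [A'] by [left_step]; truncation is
    harmless because every order met is at most n. *)
Lemma transport_left n c : (n <= N)%N ->
  asum n (fun i j => left_comp A' B' i (Phi j c)) =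
  asum n (fun i j => tensor3_series i (left_comp A B j c)).
Proof.
move=> nN.
have hl a : linear (fun y => tassoc (tmap (A' a) alpha y)).
  exact: (lin_comp (@tassoc_linear _ _ _ _) (tmap_linear _ _)).
rewrite -asumA.
transitivity (asum n (fun a m => asum m (fun p q =>
    tassoc (tmap (A' a) alpha (tensor_series p (B q c)))))).
  apply: eq_asum => a m am; rewrite -!(lin_asum _ _ (hl a)) BB' //.
  by apply: leq_trans nN; rewrite -am leq_addl.
rewrite asumA; transitivity (asum n (fun m q => asum m (fun i l =>
    tensor3_series i (tassoc (tmap (A l) alpha (B q c)))))).
  apply: eq_asum => m q mq; apply: left_step.
  by apply: leq_trans nN; rewrite -mq leq_addr.
rewrite -asumA; apply: eq_asum => i j _.
by rewrite (lin_asum _ _ (@tensor3_series_linear i)).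
Qed.

Lemma transport_right n c : (n <= N)%N ->
  asum n (fun i j => right_comp A' B' i (Phi j c)) =
  asum n (fun i j => tensor3_series i (right_comp A B j c)).
Proof.
move=> nN.
have hl a : linear (tmap alpha (A' a)) by exact: tmap_linear.
rewrite -asumA.
transitivity (asum n (fun a m => asum m (fun p q =>
    tmap alpha (A' a) (tensor_series p (B q c))))).
  apply: eq_asum => a m am; rewrite -!(lin_asum _ _ (hl a)) BB' //.
  by apply: leq_trans nN; rewrite -am leq_addl.
rewrite asumA; transitivity (asum n (fun m q => asum m (fun i l =>
    tensor3_series i (tmap alpha (A l) (B q c))))).
  apply: eq_asum => m q mq; apply: right_step.
  by apply: leq_trans nN; rewrite -mq leq_addr.
rewrite -asumA; apply: eq_asum => i j _.
by rewrite (lin_asum _ _ (@tensor3_series_linear i)).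
Qed.

End Transport.

(** * Concatenation and insertion in small tensor powers *)

Section SmallTensorPowers.
Variables (K : fieldType) (C : lmodType K).

(** Equality proofs on [nat] are unique, so the casts in [pcomp] disappear once the arities are
    numerals. *)
Lemma tpow_cast_id n (e : n = n) (x : tpow C n) : tcast e x = x.
Proof. by rewrite (eq_irrelevance e erefl). Qed.

Lemma tcat11 (x y : C) : @tcat K C 1 1 x y = x ⊗ y.
Proof.
have := @tcat_cons K C 0 1 x 1 y; rewrite /= !scale1r.
exact.
Qed.

(** Tensor powers are nested to the right, so appending a factor to a pair reassociates: this is how
    the associator enters the complex. *)
Lemma tcat21 (t : (C ⊗ C)%type) (y : C) : @tcat K C 2 1 t y = tassoc (t ⊗ y).
Proof.
move: t; apply: tensor_ext => [||v w].
- exact: (tcat_bilinear C 2 1).1 y.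
- exact: (lin_comp (@tassoc_linear _ _ _ _) ((tens_bilinear _ _).1 y)).
- by rewrite tassocE -(tcat11 w); exact: (@tcat_cons K C 1 1 v w y).
Qed.

Lemma tcat10 (x : C) : @tcat K C 1 0 x (1 : K^o) = x.
Proof.
have := @tcat_cons K C 0 0 x (1 : K^o) (1 : K^o).
by rewrite /= !scale1r.
Qed.

Lemma tcat20 (t : (C ⊗ C)%type) : @tcat K C 2 0 t (1 : K^o) = t.
Proof.
move: t; apply: tensor_ext => [||v w].
- exact: (tcat_bilinear C 2 0).1 1.
- by [].
- by rewrite -{2}[w]tcat10; exact: (@tcat_cons K C 1 0 v w 1).
Qed.

Variables (b : C -> C) (b_lin : linear b).

Lemma tpowmap1 (x : C) : @tpowmap K C b 1 x = b x.
Proof. by rewrite /= scale1r. Qed.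

Section Insert1.
Variables (f : C -> C) (f_lin : linear f).

(** The digits in the insertion lemmas are the arity of [f] and the numbers of copies of [b] on its
    left and on its right. *)
Lemma tinsert100 (c : C) : @tinsert K C b 1 f 0 0 c = f c.
Proof. exact: tcat10. Qed.

Lemma tinsert101 (t : (C ⊗ C)%type) : @tinsert K C b 1 f 0 1 t = tmap f b t.
Proof.
move: t; apply: tensor_ext => [||v w].
- exact: (@tinsert_linear K C b b_lin 1 f f_lin 0 1).
- exact: tmap_linear.
- rewrite tmapE // -(tcat11 (f v)) -[b w]tpowmap1.
  exact: (@tinsert0_cons K C b b_lin 1 f f_lin 1 v w).
Qed.

Lemma tinsert110 (t : (C ⊗ C)%type) : @tinsert K C b 1 f 1 0 t = tmap b f t.
Proof.
move: t; apply: tensor_ext => [||v w].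
- exact: (@tinsert_linear K C b b_lin 1 f f_lin 1 0).
- exact: tmap_linear.
- rewrite tmapE // -[f w]tinsert100.
  exact: (@tinsert_cons K C b b_lin 1 f f_lin 0 0 v w).
Qed.

End Insert1.

Section Insert2.
Variables (f : C -> (C ⊗ C)%type) (f_lin : linear f).

Lemma tinsert200 (c : C) : @tinsert K C b 2 f 0 0 c = f c.
Proof. exact: tcat20. Qed.

Lemma tinsert201 (t : (C ⊗ C)%type) :
  @tinsert K C b 2 f 0 1 t = tassoc (tmap f b t).
Proof.
move: t; apply: tensor_ext => [||v w].
- exact: (@tinsert_linear K C b b_lin 2 f f_lin 0 1).
- exact: (lin_comp (@tassoc_linear _ _ _ _) (tmap_linear f_lin b_lin)).
- rewrite tmapE // -(tcat21 (f v)) -[b w]tpowmap1.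
  exact: (@tinsert0_cons K C b b_lin 2 f f_lin 1 v w).
Qed.

Lemma tinsert210 (t : (C ⊗ C)%type) : @tinsert K C b 2 f 1 0 t = tmap b f t.
Proof.
move: t; apply: tensor_ext => [||v w].
- exact: (@tinsert_linear K C b b_lin 2 f f_lin 1 0).
- exact: tmap_linear.
- rewrite tmapE // -[f w]tinsert200.
  exact: (@tinsert_cons K C b b_lin 2 f f_lin 0 0 v w).
Qed.

End Insert2.
End SmallTensorPowers.

(** * Partial compositions and the differential in degrees one and two *)

Section LowDegree.
Variables (K : fieldType) (C : homDendCoalg K).
Local Notation alpha := (hdc_alpha C).

Lemma pcomp22_0 (s t : cochain C 2) (r : 'I_3) c :
  pcomp s t ord0 (label K r ⊗ c) =
  tassoc (tmap (fun d => t (Ri K (m:=2) (n:=2) ord0 r ⊗ d)) alpha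
    (s (label K (R0 (m:=2) (n:=2) ord0 r) ⊗ c))).
Proof.
(* Equalities are chained by [etrans] because the tensor powers involved, such as those of exponents
   [(2 + 2).-1] and 3, agree only by conversion. *)
apply: (etrans (pcomp_funE s t ord0 r c)); apply: (etrans (@tpow_cast_id K C 3
  _ _)).
apply: (etrans (congr1 (@tinsert K C (iter 1 alpha) 2
  (fun d => t (Ri K (m:=2) (n:=2) ord0 r ⊗ d)) 0 1) (tpow_cast_id (split_in
    ord0) _))).
apply: tinsert201; first exact: lin_fun.
exact: (@cochain_lin1 K C 2 t).
Qed.

Lemma pcomp22_1 (s t : cochain C 2) (r : 'I_3) c :
  pcomp s t ord_max (label K r ⊗ c) =
  tmap alpha (fun d => t (Ri K (m:=2) (n:=2) ord_max r ⊗ d))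
    (s (label K (R0 (m:=2) (n:=2) ord_max r) ⊗ c)).
Proof.
apply: (etrans (pcomp_funE s t ord_max r c)); apply: (etrans (@tpow_cast_id K C
  3 _ _)).
apply: (etrans (congr1 (@tinsert K C (iter 1 alpha) 2
  (fun d => t (Ri K (m:=2) (n:=2) ord_max r ⊗ d)) 1 0) (tpow_cast_id (split_in
    (@ord_max 1)) _))).
apply: tinsert210; first exact: lin_fun.
exact: (@cochain_lin1 K C 2 t).
Qed.

(** Inserting arity n puts alpha^{n-1} on the other factors: the identity here, [alpha] itself when
    n = 2. *)
Lemma pcomp21_0 (s : cochain C 2) (t : cochain C 1) (r : 'I_2) c :
  pcomp s t ord0 (label K r ⊗ c) =
  tmap (fun d => t (Ri K (m:=2) (n:=1) ord0 r ⊗ d)) id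
    (s (label K (R0 (m:=2) (n:=1) ord0 r) ⊗ c)).
Proof.
apply: (etrans (pcomp_funE s t ord0 r c)); apply: (etrans (@tpow_cast_id K C 2
  _ _)).
apply: (etrans (congr1 (@tinsert K C id 1
  (fun d => t (Ri K (m:=2) (n:=1) ord0 r ⊗ d)) 0 1) (tpow_cast_id (split_in
    ord0) _))).
by apply: tinsert101 => //; exact: (@cochain_lin1 K C 1 t).
Qed.

Lemma pcomp21_1 (s : cochain C 2) (t : cochain C 1) (r : 'I_2) c :
  pcomp s t ord_max (label K r ⊗ c) =
  tmap id (fun d => t (Ri K (m:=2) (n:=1) ord_max r ⊗ d))
    (s (label K (R0 (m:=2) (n:=1) ord_max r) ⊗ c)).
Proof.
apply: (etrans (pcomp_funE s t ord_max r c)); apply: (etrans (@tpow_cast_id K C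
  2 _ _)).
apply: (etrans (congr1 (@tinsert K C id 1
  (fun d => t (Ri K (m:=2) (n:=1) ord_max r ⊗ d)) 1 0) (tpow_cast_id (split_in
    (@ord_max 1)) _))).
by apply: tinsert110 => //; exact: (@cochain_lin1 K C 1 t).
Qed.

Lemma pcomp12 (s : cochain C 1) (t : cochain C 2) (r : 'I_2) c :
  pcomp s t ord0 (label K r ⊗ c) =
  t (Ri K (m:=1) (n:=2) ord0 r ⊗ s (label K (R0 (m:=1) (n:=2) ord0 r) ⊗ c)).
Proof.
apply: (etrans (pcomp_funE s t ord0 r c)); apply: (etrans (@tpow_cast_id K C 2
  _ _)).
apply: (etrans (congr1 (@tinsert K C (iter 1 alpha) 2
  (fun d => t (Ri K (m:=1) (n:=2) ord0 r ⊗ d)) 0 0) (tpow_cast_id (split_in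
    ord0) _))).
exact: tinsert200.
Qed.

Lemma cochain_cast_id n (e : n = n) (s : cochain C n) : cochain_cast e s = s.
Proof. by rewrite (eq_irrelevance e erefl). Qed.

Lemma cochain_evalD n (s t : cochain C n) x : (s + t) x = s x + t x.
Proof. by have := cochainP 1 s t x; rewrite !scale1r. Qed.

Lemma cochain_eval0 n x : (0 : cochain C n) x = 0.
Proof.
by apply: (addrI ((0 : cochain C n) x)); rewrite -cochain_evalD !addr0.
Qed.

Lemma cochain_evalB n (s t : cochain C n) x : (s - t) x = s x - t x.
Proof. by have := cochainP (-1) t s x; rewrite !scaleN1r ![- _ + _]addrC. Qed.

Lemma comp22 (s t : cochain C 2) : comp s t = pcomp s t ord0 - pcomp s t
  ord_max.
Proof.
rewrite /comp big_ord_recl big_ord1 /= expr0 scale1r expr1 scaleN1r.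
by rewrite (_ : ord_max = lift ord0 ord0) //; exact: val_inj.
Qed.

Lemma comp21 (s : cochain C 2) (t : cochain C 1) :
  comp s t = pcomp s t ord0 + pcomp s t ord_max.
Proof.
rewrite /comp big_ord_recl big_ord1 /= !muln0 expr0 !scale1r.
by rewrite (_ : ord_max = lift ord0 ord0) //; exact: val_inj.
Qed.

Lemma comp12 (s : cochain C 1) (t : cochain C 2) : comp s t = pcomp s t ord0.
Proof. by rewrite /comp big_ord1 expr0 scale1r. Qed.

Lemma delta1 (s : cochain C 1) :
  delta s = pcomp (coproduct C) s ord0 + pcomp (coproduct C) s ord_max
    - pcomp s (coproduct C) ord0 :> cochain C 2.
Proof.
by rewrite /delta comp21 comp12 expr0 scale1r cochain_cast_id.
Qed.

(** In degree two the sign makes both compositions additive: the differential is the linearization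
    of the quadratic expression △ • △ at the coproduct. *)
Lemma delta2 (s : cochain C 2) :
  delta s = pcomp (coproduct C) s ord0 - pcomp (coproduct C) s ord_max
    + (pcomp s (coproduct C) ord0 - pcomp s (coproduct C) ord_max) :> cochain C
      3.
Proof.
by rewrite /delta !comp22 expr1 scaleN1r opprK cochain_cast_id.
Qed.

Lemma coproductE (r : 'I_2) c :
  coproduct C (label K r ⊗ c) = if r == ord0 then hdc_prec C c else hdc_succ C
    c.
Proof. by apply: on_labelsE => i; case: (i == ord0); exact: lin_fun. Qed.

End LowDegree.

(** * The order n coefficient of a transported axiom *)

Section LeadingTerm.
Variables (K : fieldType) (C : lmodType K) (alpha : C -> C).
Hypothesis alpha_lin : linear alpha.
Variable Phi : nat -> C -> C.
Hypotheses (Phi_lin : forall i, linear (Phi i))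
  (Phi_alpha : forall i c, Phi i (alpha c) = alpha (Phi i c))
  (Phi0 : forall c, Phi 0%N c = c).

Lemma tensor_series_alpha n (t : (C ⊗ C)%type) :
  tmap alpha alpha (tensor_series Phi n t) =
  tensor_series Phi n (tmap alpha alpha t).
Proof.
rewrite (lin_asum _ _ (tmap_linear alpha_lin alpha_lin)).
apply: eq_asum => i j _; rewrite !tmap_comp //.
by apply: eq_tmap => c /=.
Qed.

Lemma tensor_series0 (t : (C ⊗ C)%type) : tensor_series Phi 0 t = t.
Proof.
rewrite /tensor_series asum0 -[RHS]tmap_id; exact: eq_tmap.
Qed.

Definition vanishes_below n (X : nat -> C -> (C ⊗ C)%type) : Prop :=
  forall i c, (0 < i < n)%N -> X i c = 0.

(* The coefficient at t^n of an identity (A' ⊗ alpha) B' = (alpha ⊗ G') H'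
   between series of the form X'_0 + t^n X'_n, deduced from the corresponding
   identity for the intertwined series A, B, G, H. *)
Lemma leading_term n (A A' B B' G G' H H' : nat -> C -> (C ⊗ C)%type) :
  (0 < n)%N ->
  (forall i, linear (A i)) -> (forall i, linear (A' i)) ->
  (forall i, linear (G i)) -> (forall i, linear (G' i)) ->
  intertwined Phi n A A' -> intertwined Phi n B B' ->
  intertwined Phi n G G' -> intertwined Phi n H H' ->
  vanishes_below n A' -> vanishes_below n B' ->
  vanishes_below n G' -> vanishes_below n H' ->
  (forall k c, left_comp alpha A B k c = right_comp alpha G H k c) ->
  (forall c, tassoc (tmap (A' 0%N) alpha (B' 0%N c)) =
             tmap alpha (G' 0%N) (H' 0%N c)) ->
  forall c,
    tassoc (tmap (A' 0%N) alpha (B' n c)) + tassoc (tmap (A' n) alpha (B' 0%N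
      c)) =
    tmap alpha (G' 0%N) (H' n c) + tmap alpha (G' n) (H' 0%N c).
Proof.
move=> n0 lA lA' lG lG' AA' BB' GG' HH' vA vB vG vH axD ax0 c.
have hL i : linear (fun y => tassoc (tmap (A' i) alpha y)).
  exact: (lin_comp (@tassoc_linear _ _ _ _) (tmap_linear (lA' i) alpha_lin)).
have hR i : linear (tmap alpha (G' i)) by exact: tmap_linear.
have L0 i x : (0 < i < n)%N -> tassoc (tmap (A' i) alpha x) = 0.
  move=> hi; rewrite tmap0l // ?(lin0 (@tassoc_linear _ _ _ _)) // => v.
  exact: vA.
have R0 i x : (0 < i < n)%N -> tmap alpha (G' i) x = 0.
  by move=> hi; rewrite tmap0r // => v; exact: vG.
have Ln x : left_comp alpha A' B' n x =
    tassoc (tmap (A' 0%N) alpha (B' n x)) + tassoc (tmap (A' n) alpha (B' 0%N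
      x)).
  by rewrite /left_comp asum_ends // => i j hi _; exact: L0.
have Rn x : right_comp alpha G' H' n x =
    tmap alpha (G' 0%N) (H' n x) + tmap alpha (G' n) (H' 0%N x).
  by rewrite /right_comp asum_ends // => i j hi _; exact: R0.
rewrite -Ln -Rn; apply/eqP; rewrite -subr_eq0; apply/eqP.
(* The defect of the primed identity, composed with Phi; the goal is that it vanishes at order n. *)
pose h i j := left_comp alpha A' B' i (Phi j c) - right_comp alpha G' H' i (Phi
  j c).
(* Order 0 is [ax0]. For 0 < i < n only the terms with outer index 0 remain, and they contain a
   vanishing coefficient of [B'] or [H']. *)
have hlt i j : (i < n)%N -> h i j = 0.
  case: i => [|i] hi; rewrite /h /left_comp /right_comp.
    by rewrite !asum0 ax0 subrr.
  rewrite (asum_head hi) => [|k l]; last exact: L0.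
  rewrite (asum_head hi) => [|k l]; last exact: R0.
  by rewrite vB ?vH // (lin0 (hL _)) (lin0 (hR _)) subrr.
(* Transport turns this sum into Phi ⊗ Phi ⊗ Phi applied to the defect of the unprimed series, which
   [axD] makes zero. Hence [h n 0] vanishes too, and Phi_0 = id concludes. *)
have : asum n h = 0.
  rewrite asumB (transport_left alpha_lin Phi_lin Phi_alpha lA lA' AA' BB') //.
  rewrite (transport_right alpha_lin Phi_lin Phi_alpha lG lG' GG' HH') //.
  by rewrite -asumB; apply: asum_eq0 => k l _; rewrite axD subrr.
rewrite asum_ends //; last by move=> k l /andP[_ kn] _; exact: hlt.
by rewrite hlt // add0r /h Phi0.
Qed.

End LeadingTerm.

(** * Explicit cocycles and coboundaries in degree two *)

Section Cocycles.
Variables (K : fieldType) (C : homDendCoalg K).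
Local Notation alpha := (hdc_alpha C).
Local Notation prec := (hdc_prec C).
Local Notation succ := (hdc_succ C).

Lemma Ri1 m (i : 'I_m) r : Ri K (n:=1) i r = label K ord0.
Proof.
rewrite /Ri; case: ifP => [ir|_]; last by rewrite big_ord1.
rewrite big_mkcond big_ord1 /= ifT // addn0.
by case/andP: ir; rewrite (addn1 i) ltnS eqn_leq => -> ->.
Qed.

Lemma Ri_in m (i : 'I_m) (r : 'I_(m + 2).-1) (k : 'I_2) :
  (r = i + k :> nat)%N -> Ri K (n:=2) i r = label K k.
Proof.
move=> rik; rewrite /Ri rik leq_addr ltn_add2l ltn_ord /=.
rewrite (bigD1 k) //= big1 ?addr0 // => j /andP[/eqP/addnI kj].
by rewrite (val_inj kj) eqxx.
Qed.

Lemma Ri_out m (i : 'I_m) (r : 'I_(m + 2).-1) :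
  ~~ (i <= r < i + 2)%N -> Ri K (n:=2) i r = label K ord0 + label K ord_max.
Proof.
move=> /negPf out; rewrite /Ri out big_ord_recl big_ord1.
by rewrite (_ : ord_max = lift ord0 ord0) //; exact: val_inj.
Qed.

Definition on_two_labels (s : cochain C 2) (p q : C -> (C ⊗ C)%type) : Prop :=
  forall (r : 'I_2) c, s (label K r ⊗ c) = if r == ord0 then p c else q c.

Lemma coproduct_on_labels : on_two_labels (coproduct C) prec succ.
Proof. exact: coproductE. Qed.

Lemma cochain2_sum (s : cochain C 2) p q : on_two_labels s p q ->
  forall c, s ((label K ord0 + label K ord_max) ⊗ c) = p c + q c.
Proof.
move=> spq c; rewrite (linD ((tens_bilinear _ _).1 c)) (linD (@cochain_linear K
  C 2 s)).
by rewrite !spq.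
Qed.

(** The three labels of arity three yield the three linearized axioms: [R0] selects the coproduct
    applied first, [Ri] the one applied next, with the sum of both when the label lies outside the
    inserted block. *)
Lemma cocycle2P (s : cochain C 2) (p q : C -> (C ⊗ C)%type) :
  on_two_labels s p q ->
  (forall c, tassoc (tmap prec alpha (p c)) + tassoc (tmap p alpha (prec c)) =
    tmap alpha (prec \+ succ) (p c) + tmap alpha (p \+ q) (prec c)) ->
  (forall c, tassoc (tmap succ alpha (p c)) + tassoc (tmap q alpha (prec c)) =
    tmap alpha prec (q c) + tmap alpha p (succ c)) ->
  (forall c, tassoc (tmap (prec \+ succ) alpha (q c)) +
      tassoc (tmap (p \+ q) alpha (succ c)) =
    tmap alpha succ (q c) + tmap alpha q (succ c)) ->
  delta s = 0.
Proof.
move=> spq e1 e2 e3; apply: cochain_ext => r c.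
have -> (x : 'rV_3 ⊗ C) : (0 : cochain C 3) x = 0 by exact: cochain_eval0.
rewrite delta2.
rewrite cochain_evalD !cochain_evalB !pcomp22_0 !pcomp22_1.
(* Here a and x come from △ • s, while b and y come from s • △. *)
have rearr (V : zmodType) (a b x y : V) : b + a = y + x -> a - x + (b - y) = 0.
  by move=> h; rewrite addrACA -opprD [a + b]addrC h [x + y]addrC subrr.
have s0 : (fun d => s (label K ord0 ⊗ d)) = p by apply: funext => d; rewrite
  spq.
have s1 : (fun d => s (label K ord_max ⊗ d)) = q by apply: funext => d; rewrite
  spq.
have ssum : (fun d => s ((label K ord0 + label K ord_max) ⊗ d)) = p \+ q.
  by apply: funext => d; exact: cochain2_sum.
have d0 : (fun d => coproduct C (label K ord0 ⊗ d)) = prec.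
  by apply: funext => d; rewrite coproduct_on_labels.
have d1 : (fun d => coproduct C (label K ord_max ⊗ d)) = succ.
  by apply: funext => d; rewrite coproduct_on_labels.
have dsum : (fun d => coproduct C ((label K ord0 + label K ord_max) ⊗ d)) =
    prec \+ succ.
  by apply: funext => d; exact: (cochain2_sum coproduct_on_labels).
have [E|[E|E]] : (r = 0 :> nat) \/ (r = 1 :> nat) \/ (r = 2 :> nat).
- by case: r => [[|[|[|?]]] ?]; auto.
- have R00 : R0 (m:=2) (n:=2) ord0 r = ord0 by apply: val_inj; rewrite /= E.
  have R01 : R0 (m:=2) (n:=2) ord_max r = ord0 by apply: val_inj; rewrite /= E.
  rewrite R00 R01 (@Ri_in 2 ord0 r ord0) ?E // (@Ri_out 2 ord_max r) ?E //.
  by rewrite s0 ssum d0 dsum !spq !coproduct_on_labels /=; exact/rearr/e1.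
- have R00 : R0 (m:=2) (n:=2) ord0 r = ord0 by apply: val_inj; rewrite /= E.
  have R01 : R0 (m:=2) (n:=2) ord_max r = ord_max by apply: val_inj; rewrite /=
    E.
  rewrite R00 R01 (@Ri_in 2 ord0 r ord_max) ?E // (@Ri_in 2 ord_max r ord0) ?E
    //.
  by rewrite s0 s1 d0 d1 !spq !coproduct_on_labels /=; exact/rearr/e2.
- have R00 : R0 (m:=2) (n:=2) ord0 r = ord_max by apply: val_inj; rewrite /= E.
  have R01 : R0 (m:=2) (n:=2) ord_max r = ord_max by apply: val_inj; rewrite /=
    E.
  rewrite R00 R01 (@Ri_out 2 ord0 r) ?E // (@Ri_in 2 ord_max r ord_max) ?E //.
  by rewrite ssum s1 dsum d1 !spq !coproduct_on_labels /=; exact/rearr/e3.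
Qed.

(** The coboundary measures how far f is from being a coderivation of each coproduct; arity one has
    a single label, so one f serves both. *)
Lemma delta1E (t : cochain C 1) (r : 'I_2) c :
  let f d := t (label K ord0 ⊗ d) in
  let D d := if r == ord0 then prec d else succ d in
  delta t (label K r ⊗ c) = tmap f id (D c) + tmap id f (D c) - D (f c).
Proof.
move=> f D; rewrite delta1 cochain_evalB cochain_evalD.
rewrite pcomp21_0 pcomp21_1 pcomp12 !Ri1.
have R00 : R0 (m:=2) (n:=1) ord0 r = r.
  by apply: val_inj; case: r {D} => [[|[|?]] ?].
have R01 : R0 (m:=2) (n:=1) ord_max r = r.
  by apply: val_inj; case: r {D R00} => [[|[|?]] ?].
have R02 : R0 (m:=1) (n:=2) ord0 r = ord0 by apply: val_inj; rewrite ord1.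
by rewrite R00 R01 R02 (@Ri_in 1 ord0 r r) // !coproduct_on_labels.
Qed.

End Cocycles.

Lemma cohomology2_eq0 (K : fieldType) (C : homDendCoalg K) :
  (forall x : cohomology C 2, x = 0) ->
  forall s : cochain C 2, delta s = 0 -> exists t : cochain C 1, delta t = s.
Proof.
move=> H0 s ds; have hs : s \in @cocycle_pred K C 2 by exact/eqP.
pose z := Cocycle hs.
have : mqpi (@coboundary_submod_closed K C 2) z == mqpi
  (@coboundary_submod_closed K C 2) 0.
  apply/eqP; exact: (etrans (H0 _) (esym (H0 _))).
by rewrite mqpi_eq subr0 => /asboolP[t tz]; exists t.
Qed.

(** * Order by order construction of the trivialization *)

Section Rigidity.
Variables (K : fieldType) (C : homDendCoalg K) (D : deformation C).
Local Notation alpha := (hdc_alpha C).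
Local Notation prec := (hdc_prec C).
Local Notation succ := (hdc_succ C).
Implicit Types Phi : nat -> {linear C -> C}.

Definition transported Phi (X : nat -> C -> (C ⊗ C)%type) n c :
    (C ⊗ C)%type :=
  asum n (fun i j => tensor_series Phi i (X j c)).

(** The target coproducts are constant in t, so the left sides reduce to the single term containing
    Phi_n. *)
Definition trivializes_at Phi n : Prop := forall c,
  prec (Phi n c) = transported Phi (def_prec D) n c /\
  succ (Phi n c) = transported Phi (def_succ D) n c.

Definition trivializes_below Phi n : Prop :=
  [/\ forall c, Phi 0%N c = c,
      forall i c, Phi i (alpha c) = alpha (Phi i c)
    & forall k, (k < n)%N -> trivializes_at Phi k].

Definition update Phi n (phi : {linear C -> C}) : nat -> {linear C -> C} :=
  fun i => if i == n then phi else Phi i.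

(** Order n involves only the coefficients of Phi up to n, so later corrections do not disturb the
    orders already settled. *)
Lemma eq_trivializes_at Phi Psi n :
  (forall i, (i <= n)%N -> Phi i = Psi i) ->
  trivializes_at Phi n -> trivializes_at Psi n.
Proof.
move=> PP h c; have [h1 h2] := h c.
have T X : transported Psi X n c = transported Phi X n c.
  apply: eq_asum => i j ij; apply: eq_asum => a b ab.
  by rewrite !PP // -ij -ab -?addnA ?leq_addr // addnCA leq_addr.
by rewrite !T -h1 -h2 PP.
Qed.

Hypothesis H2_eq0 : forall x : cohomology C 2, x = 0.

Section Step.
Variables (Phi : nat -> {linear C -> C}) (n : nat).
Hypotheses (n_gt0 : (0 < n)%N) (Phi_ok : trivializes_below Phi n).

Let Phi0 : forall c, Phi 0%N c = c. Proof. by case: Phi_ok. Qed.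
Let Phi_alpha : forall i c, Phi i (alpha c) = alpha (Phi i c).
Proof. by case: Phi_ok. Qed.
Let Phi_lin i : linear (Phi i). Proof. exact: lin_fun. Qed.
Let alpha_lin : linear alpha. Proof. exact: lin_fun. Qed.

Section Obstruction.
Variables (d : {linear C -> (C ⊗ C)%type}) (X : nat -> {linear C -> (C ⊗
  C)%type}).
Hypotheses (X0 : X 0%N =1 d)
  (d_alpha : forall c, tmap alpha alpha (d c) = d (alpha c))
  (X_alpha : forall i c, tmap alpha alpha (X i c) = X i (alpha c)).
Hypothesis X_ok : forall k, (k < n)%N -> forall c,
  d (Phi k c) = transported Phi X k c.

Definition obstruction c : (C ⊗ C)%type := transported Phi X n c - d (Phi n c).

Lemma obstruction_linear : linear obstruction.
Proof.
move=> a x y; rewrite /obstruction.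
have -> : transported Phi X n (a *: x + y) =
    a *: transported Phi X n x + transported Phi X n y.
  apply: (@asum_linear K C (C ⊗ C)%type n
    (fun i j c => tensor_series Phi i (X j c))) => i j.
  exact: (lin_comp (tensor_series_linear Phi_lin i) (lin_fun (X j))).
by rewrite (Phi_lin n) (lin_fun d) scalerBr opprD addrACA.
Qed.

Lemma obstruction_alpha c :
  tmap alpha alpha (obstruction c) = obstruction (alpha c).
Proof.
have h := tmap_linear alpha_lin alpha_lin.
rewrite /obstruction -scaleN1r addrC h scaleN1r d_alpha Phi_alpha addrC.
congr (_ - _); rewrite (lin_asum _ _ h); apply: eq_asum => i j _.
by rewrite tensor_series_alpha // X_alpha.
Qed.

(* The coefficients of the truncated coproduct △ + t^n E. *)
Definition perturbed i : C -> (C ⊗ C)%type :=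
  if i == 0%N then (d : C -> (C ⊗ C)%type) else if i == n then obstruction else
    fun=> 0.

Lemma perturbedn : perturbed n = obstruction.
Proof. by rewrite /perturbed eqn0Ngt n_gt0 eqxx. Qed.

Lemma perturbed_vanishes : vanishes_below n perturbed.
Proof. by move=> i c /andP[i0 ilt]; rewrite /perturbed gtn_eqF // ltn_eqF. Qed.

Lemma perturbed_linear i : linear (perturbed i).
Proof.
rewrite /perturbed; case: eqP => _; first exact: lin_fun.
case: eqP => _; first exact: obstruction_linear.
by move=> a x y; rewrite scaler0 addr0.
Qed.

(** Below order n this is [X_ok]; at order n the extra term is the obstruction after Phi_0 = id,
    which is exactly the missing amount. *)
Lemma perturbed_intertwined : intertwined Phi n X perturbed.
Proof.
move=> k c; rewrite leq_eqVlt => /orP[/eqP-> | kn].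
  rewrite asum_ends // => [|i j hi _]; last exact: perturbed_vanishes.
  by rewrite perturbedn Phi0 /obstruction addrC subrK.
rewrite (asum_head kn) => [|i j hi]; last exact: perturbed_vanishes.
exact: X_ok.
Qed.

Variable phi : {linear C -> C}.
Hypothesis phiE : forall c,
  tmap (fun x => Phi n x - phi x) id (d c) +
  tmap id (fun x => Phi n x - phi x) (d c) - d (Phi n c - phi c) = obstruction
    c.

(** With g = Phi_n - phi, the left side drops by d g and the right side by (g ⊗ id + id ⊗ g) d. By
    [phiE] the difference of these changes is the obstruction. *)
Lemma obstruction_killed c :
  d (update Phi n phi n c) = transported (update Phi n phi) X n c.
Proof.
pose g x := Phi n x - phi x; pose Psi := update Phi n phi.
have g_lin : linear g.
  move=> a x y; rewrite /g (Phi_lin n) (lin_fun phi).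
  by rewrite scalerBr opprD addrACA.
have Psi_lt i : (i < n)%N -> Psi i = Phi i.
  by move=> hi; rewrite /Psi /update ltn_eqF.
have Psin : Psi n = phi by rewrite /Psi /update eqxx.
have PhinE : Phi n =1 phi \+ g by move=> x /=; rewrite /g addrC subrK.
have id_lin : linear (@id C) by [].
have Phi0E : Phi 0%N =1 id by [].
have TS i t : (i < n)%N -> tensor_series Psi i t = tensor_series Phi i t.
  move=> hi; apply: eq_asum => a b ab.
  by rewrite !Psi_lt //; apply: leq_ltn_trans hi; rewrite -ab ?leq_addr
    ?leq_addl.
(* Phi_n occurs only in the two end terms, each time paired with Phi_0 = id. *)
have TSn t : tensor_series Psi n t =
    tensor_series Phi n t - (tmap g id t + tmap id g t).
  apply/eqP; rewrite eq_sym subr_eq addrC -subr_eq eq_sym; apply/eqP.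
  rewrite -asumB asum_ends // => [|i j /andP[i0 ilt] ij]; last first.
    rewrite !Psi_lt ?subrr //.
    by rewrite -ij -[X in (X < _)%N]add0n ltn_add2r.
  rewrite Psin (Psi_lt 0%N) //.
  rewrite !(eq_tmap Phi0E (frefl _)) !(eq_tmap (frefl _) Phi0E).
  rewrite (eq_tmap (frefl _) PhinE) (eq_tmap PhinE (frefl _)).
  rewrite (tmapDr t id_lin (lin_fun phi) g_lin) (tmapDl t (lin_fun phi) g_lin
    id_lin).
  by rewrite ![_ + _ - tmap _ _ _]addrC !addKr addrC.
(* Only the summand with the tensor series of order n changes, and it is applied to X_0 = d. *)
have TX : transported Psi X n c =
    transported Phi X n c - (tmap g id (d c) + tmap id g (d c)).
  apply/eqP; rewrite eq_sym subr_eq addrC -subr_eq eq_sym; apply/eqP.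
  rewrite -asumB asum_ends // => [|i j /andP[i0 ilt] _]; last first.
    by rewrite TS ?subrr.
  by rewrite TS // subrr add0r TSn X0 opprB addrCA subrr addr0.
have dg : d (g c) = d (Phi n c) - d (phi c) by exact: raddfB.
rewrite -/Psi TX Psin; have := phiE c; rewrite -/(g c) -/g dg /obstruction => e.
apply/eqP; rewrite eq_sym subr_eq; apply/eqP; move/eqP: e.
by rewrite subr_eq => /eqP->; rewrite subrKA addrC subrK.
Qed.

End Obstruction.

Lemma extend_trivialization : exists phi : {linear C -> C},
  trivializes_below (update Phi n phi) n.+1.
Proof.
have ok_prec k : (k < n)%N -> forall c, prec (Phi k c) = transported Phi
  (def_prec D) k c.
  by case: Phi_ok => _ _ h kn c; case: (h k kn c).
have ok_succ k : (k < n)%N -> forall c, succ (Phi k c) = transported Phi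
  (def_succ D) k c.
  by case: Phi_ok => _ _ h kn c; case: (h k kn c).
pose p := obstruction prec (def_prec D); pose q := obstruction succ (def_succ
  D).
pose P := perturbed prec (def_prec D); pose S := perturbed succ (def_succ D).
have Pint : intertwined Phi n (def_prec D) P by exact: perturbed_intertwined.
have Sint : intertwined Phi n (def_succ D) S by exact: perturbed_intertwined.
have PSint := intertwinedD Phi_lin Pint Sint.
have Pl i : linear (P i) by exact: perturbed_linear.
have Sl i : linear (S i) by exact: perturbed_linear.
have PSl i : linear (P i \+ S i).
  by move=> a x y /=; rewrite Pl Sl scalerDr addrACA.
have dl i : linear (def_prec D i \+ def_succ D i) by exact: lin_fun.
have Pv : vanishes_below n P by exact: perturbed_vanishes.
have Sv : vanishes_below n S by exact: perturbed_vanishes.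
have PSv : vanishes_below n (fun i => P i \+ S i).
  by move=> i c hi /=; rewrite Pv // Sv // addr0.
have Pn : P n = p by exact: perturbedn.
have Sn : S n = q by exact: perturbedn.
pose F (r : 'I_2) (c : C) : tpow C 2 := if r == ord0 then p c else q c.
have F_lin r : linear (F r).
  by rewrite /F; case: (r == ord0); exact: obstruction_linear.
have F_mem : on_labels F \in @cochain_pred K C 2.
  apply: on_labels_mem => // r c; rewrite tpowmap2; last exact: lin_fun.
  rewrite /F; case: ifP => _; apply: obstruction_alpha;
    try exact: hdc_mult_prec; try exact: hdc_mult_succ;
    try exact: def_mult_prec; exact: def_mult_succ.
pose s := Cochain F_mem.
have spq : on_two_labels s p q by move=> r c; exact: on_labelsE.
have ds : delta s = 0.
  (* Once p and q are read as order n coefficients of the truncated coproducts, each condition is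
     [leading_term] for one axiom of [D]. *)
  apply: (cocycle2P spq) => c; rewrite -Pn -Sn.
  - apply: (@leading_term K C alpha alpha_lin Phi Phi_lin Phi_alpha Phi0 n
      (def_prec D) P (def_prec D) P (fun i => def_prec D i \+ def_succ D i)
      (fun i => P i \+ S i) (def_prec D) P) => //.
    + by move=> i; exact: lin_fun.
    + exact: def_axiom1.
    + exact: hdc_axiom1.
  - apply: (@leading_term K C alpha alpha_lin Phi Phi_lin Phi_alpha Phi0 n
      (def_succ D) S (def_prec D) P (def_prec D) P (def_succ D) S) => //.
    + by move=> i; exact: lin_fun.
    + by move=> i; exact: lin_fun.
    + exact: def_axiom2.
    + exact: hdc_axiom2.
  - apply: (@leading_term K C alpha alpha_lin Phi Phi_lin Phi_alpha Phi0 n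
      (fun i => def_prec D i \+ def_succ D i) (fun i => P i \+ S i)
      (def_succ D) S (def_succ D) S (def_succ D) S) => //.
    + by move=> i; exact: lin_fun.
    + exact: def_axiom3.
    + exact: hdc_axiom3.
have [t tE] := cohomology2_eq0 H2_eq0 ds.
pose f (c : C) : C := t (label K ord0 ⊗ c).
have f_lin : linear f by exact: (@cochain_lin1 K C 1 t).
have g_lin : linear (fun c => Phi n c - f c).
  by move=> a x y; rewrite (Phi_lin n) f_lin scalerBr opprD addrACA.
have fE x : Phi n x - (Phi n x - f x) = f x by rewrite opprB addrC subrK.
have f_alpha c : f (alpha c) = alpha (f c).
  by rewrite /f -(cochain_alpha t) tpowmap1.
(* The new coefficient is Phi_n - f, where t cobounds the obstruction; index 0 is untouched because
   n is positive. *)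
exists (mklin g_lin); have lt0 : (0 == n) = false by rewrite eq_sym eqn0Ngt
  n_gt0.
split=> [c|i c|k].
- by rewrite /update lt0.
- rewrite /update; case: eqP => // _ /=.
  by rewrite Phi_alpha f_alpha linearB.
rewrite ltnS leq_eqVlt => /orP[/eqP-> | kn]; last first.
  apply: (@eq_trivializes_at Phi); last by case: Phi_ok => _ _; exact.
  by move=> i ik; rewrite /update ltn_eqF // (leq_ltn_trans ik).
have fE1 x : Phi n x - mklin g_lin x = f x by exact: fE.
have fE2 : (fun x => Phi n x - mklin g_lin x) = f by exact: funext.
move=> c; split; apply: obstruction_killed.
- exact: def_prec0.
(* What remains is the equation [delta t = s] read at the first label, and below at the second. *)
- move=> e; rewrite fE2 fE1.
  by rewrite -[RHS](spq ord0) -tE delta1E.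
- exact: def_succ0.
- move=> e; rewrite fE2 fE1.
  by rewrite -[RHS](spq ord_max) -tE delta1E.
Qed.

End Step.

Lemma trivialization_exists : exists Phi : nat -> {linear C -> C},
  [/\ forall c, Phi 0%N c = c,
      forall i c, Phi i (alpha c) = alpha (Phi i c)
    & forall n, trivializes_at Phi n].
Proof.
(* The implication sits under the existential so that [choice] applies to every pair; where its
   premise fails, [\0] is an arbitrary value. *)
have step (x : nat * (nat -> {linear C -> C})) : exists phi : {linear C -> C},
    trivializes_below x.2 x.1.+1 ->
    trivializes_below (update x.2 x.1.+1 phi) x.1.+2.
  case: x => n Phi /=; have [ok|bad] := pselect (trivializes_below Phi n.+1).
    by have [phi h] := extend_trivialization (ltn0Sn n) ok; exists phi.
  by exists \0.
have [f fP] := choice step.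
pose start : nat -> {linear C -> C} := fun i => if i is 0 then idfun else \0.
(* [F n] is the family after corrections at orders 1 to n. Coefficient i is final from [F i] on, so
   the diagonal is the trivialization. *)
pose F := fix F n := if n is m.+1 then update (F m) m.+1 (f (m, F m)) else
  start.
have start_ok : trivializes_below start 1.
  split=> [//|[|i] c /=|[|//] _ c]; rewrite ?linear0 //.
  rewrite /transported !asum0 !tensor_series0 //=.
  by rewrite def_prec0 def_succ0.
have F_ok n : trivializes_below (F n) n.+1.
  by elim: n => [//|n IHn]; exact: (fP (n, F n)).
have F_stable m i : (i <= m)%N -> F m i = F i i.
  elim: m => [|m IHm]; first by rewrite leqn0 => /eqP->.
  rewrite leq_eqVlt => /orP[/eqP-> //|im] /=.
  by rewrite {1}/update ltn_eqF // IHm.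
exists (fun n => F n n); split=> [c|i c|n].
- by case: (F_ok 0%N).
- by case: (F_ok i).
apply: (@eq_trivializes_at (F n)) => [i /F_stable //|].
by case: (F_ok n) => _ _; apply.
Qed.

End Rigidity.

(** * From trivializations to equivalence of deformations *)

Lemma sum_const_coef (K : fieldType) (C : homDendCoalg K)
    (d : {linear C -> (C ⊗ C)%type}) (x : nat -> C) n :
  \sum_(i < n.+1) const_coef d i (x (n - i)%N) = d (x n).
Proof. by rewrite big_ord_recl /= subn0 big1 ?addr0. Qed.

Theorem theorem5p5 (K : fieldType) (K_char0 : [pchar K] =i pred0)
    (C : homDendCoalg K) :
  (forall x : cohomology C 2, x = 0) ->
  forall D : deformation C,
    exists D' : deformation C, trivial_deformation D' /\ equivalent D D'.
Proof.
move=> H2 D; exists (const_deformation C).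
(* Stated for an arbitrary deformation in order to serve both for [D] and for the constant
   deformation itself. *)
have trivialize (D1 : deformation C) : equivalent D1 (const_deformation C).
  have [Phi [Phi0 Phi_alpha PhiE]] := trivialization_exists D1 H2.
  exists Phi; split=> // n c; have [h1 h2] := PhiE n c.
  (* [asumC] is needed since [equivalent] indexes its outer sum by the order in the deformation,
     [transported] by the order in Phi ⊗ Phi. *)
  - by rewrite (sum_const_coef (hdc_prec C) (fun k => Phi k c)) h1 /transported asumC.
  - by rewrite (sum_const_coef (hdc_succ C) (fun k => Phi k c)) h2 /transported asumC.
by split; exact: trivialize.
Qed.
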